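(* Let $H_1$ be a graph and $H_2$ be a forest with $\min\{e(H_1),e(H_2)\}\geq 2$. (i) If $H_1$ is a matching and $H_2$ is not a short forest, then $n^{-1}$ is a threshold function for the property $G(n,p)\xrightarrow{\mathrm{mr}}(H_1,H_2)$. (ii) If $H_1$ is not a forest and $H_2$ is a cherry, or else $H_1$ is arbitrary and $H_2$ is a $2$-edge matching, then $n^{-1/m(H_1)}$ is a threshold function for the property $G(n,p)\xrightarrow{\mathrm{mr}}(H_1,H_2)$. (iii) If $H_1$ is a forest with $k$ non-isolated vertices and $H_2$ is a cherry, then $n^{-k/(k-1)}$ is a threshold function for the property $G(n,p)\xrightarrow{\mathrm{mr}}(H_1,H_2)$.
   Context: All graphs are finite and simple; $v(H)$ and $e(H)$ denote the numbers of vertices and edges of $H$. $G(n,p)$ is the binomial random graph on $n$ vertices. For graphs $G,H_1,H_2$, write $G\xrightarrow{\mathrm{mr}}(H_1,H_2)$ if in every colouring of $E(G)$ (with no restriction on the number of colours used) there is a monochromatic copy of $H_1$ (a not necessarily induced copy of $H_1$ in $G$ with all edges of the same colour) or a rainbow copy of $H_2$ (a copy of $H_2$ in $G$ with no two edges of the same colour). A function $\hat p\colon\mathbb N\to[0,1]$ is a threshold function for a graph property $\mathcal P$ if $\lim_{n\to\infty}\mathbb P[G(n,p)\in\mathcal P]=1$ for every $p=p(n)\in[0,1]$ with $p\gg\hat p$ and $\lim_{n\to\infty}\mathbb P[G(n,p)\in\mathcal P]=0$ for every $p=p(n)\in[0,1]$ with $p\ll\hat p$, where $p\gg\hat p$ means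 $p(n)/\hat p(n)\to\infty$ and $p\ll \hat p$ means $p(n)/\hat p(n)\to0$. The maximum density of a graph $H$ with $v(H)\ge1$ is $m(H)=\max\{\frac{e(J)}{v(J)} : J\subset H,\ v(J)\ge 1\}$, over subgraphs $J$ of $H$. A cherry is $K_{1,2}$. A matching is a disjoint union of edges. A short forest is a disjoint union of edges and cherries. Isolated vertices are disregarded in these notions: a graph is called a cherry, a matching or a short forest if the graph obtained by deleting its isolated vertices is one. *)

(* Defs.v *)
From HB Require Import structures.
From mathcomp Require Import all_boot all_order all_algebra.
From mathcomp Require Import all_classical all_reals all_analysis.

Set Implicit Arguments.
Unset Strict Implicit.
Unset Printing Implicit Defensive.

Import Order.TTheory GRing.Theory Num.Theory.
Import numFieldNormedType.Exports.

Local Open Scope ring_scope.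

(* A finite simple graph on V is a set of 2-element subsets of V. *)
Record sgraph (V : finType) := SGraph {
  edges :> {set {set V}};
  _ : [forall e in edges, #|e| == 2%N] }.

HB.instance Definition _ (V : finType) := [isSub for @edges V].
HB.instance Definition _ (V : finType) := [Finite of sgraph V by <:].

Section Graphs.
Variable V : finType.
Implicit Types H : sgraph V.

Definition num_edges H : nat := #|edges H|.

Definition adj H : rel V := fun u v => [set u; v] \in edges H.

Definition nonisolated H : {set V} := [set v | [exists w, adj H v w]].

(* No cycles; ucycle also accepts sequences of at most two vertices, which are
   not cycles of the graph. *)
Definition is_forest H : Prop :=
  forall s : seq V, ucycle (adj H) s -> (size s < 3)%N.

Definition cherry_edges (B : {set {set V}}) : Prop :=
  exists x y z : V, uniq [:: x; y; z] /\ B = [set [set x; y]; [set x; z]].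

(* Being determined by the edge set, the next three notions disregard isolated
   vertices. *)
Definition is_cherry H : Prop := cherry_edges (edges H).

Definition is_matching H : Prop := finset.trivIset (edges H).

(* The edge set splits into pairwise vertex-disjoint blocks, each of them a
   single edge or a cherry. *)
Definition is_short_forest H : Prop :=
  exists P : {set {set {set V}}},
    [/\ finset.partition P (edges H),
        forall B, B \in P -> #|B| = 1%N \/ cherry_edges B
      & forall B C, B \in P -> C \in P -> B != C ->
          [disjoint finset.cover B & finset.cover C]].

(* (J.1, J.2) is the subgraph of H with vertex set J.1 and edge set J.2. *)
Definition is_subgraph (J : {set V} * {set {set V}}) H : bool :=
  (J.2 \subset edges H) && [forall e in J.2, e \subset J.1].

(* The neutral element 0 is harmless: all the ratios are nonnegative. *)
Definition max_density (R : realType) H : R :=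
  \big[Num.max/0]_(J : {set V} * {set {set V}} |
        is_subgraph J H && (J.1 != finset.set0))
    (#|J.2|%:R / #|J.1|%:R).

End Graphs.

Section Arrow.
Variables (W : finType) (G : sgraph W).

Definition is_copy (V : finType) (H : sgraph V) (f : V -> W) : Prop :=
  injective f /\ forall e, e \in edges H -> f @: e \in edges G.

(* Only the values of the colouring c on edges of G matter. *)
Definition monochromatic_copy (c : {set W} -> nat) (V : finType)
    (H : sgraph V) : Prop :=
  exists f : V -> W, is_copy H f /\
    forall e e', e \in edges H -> e' \in edges H -> c (f @: e) = c (f @: e').

Definition rainbow_copy (c : {set W} -> nat) (V : finType)
    (H : sgraph V) : Prop :=
  exists f : V -> W, is_copy H f /\
    forall e e', e \in edges H -> e' \in edges H -> e != e' ->
      c (f @: e) <> c (f @: e').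

(* G is finite, so colours in nat amount to an unrestricted palette. *)
Definition mr_arrow (V1 V2 : finType) (H1 : sgraph V1) (H2 : sgraph V2)
    : Prop :=
  forall c : {set W} -> nat, monochromatic_copy c H1 \/ rainbow_copy c H2.

End Arrow.

Section RandomGraph.
Variable R : realType.
Local Open Scope classical_set_scope.
Local Open Scope ring_scope.

(* The probability that G(n, p) has property P. *)
Definition prob_Gnp (n : nat) (p : R) (P : sgraph 'I_n -> Prop) : R :=
  \sum_(G : sgraph 'I_n | `[< P G >])
    p ^+ num_edges G * (1 - p) ^+ ('C(n, 2) - num_edges G).

Definition is_threshold (phat : nat -> R)
    (P : forall n, sgraph 'I_n -> Prop) : Prop :=
  [/\ forall n, 0 <= phat n <= 1,
      forall p : nat -> R, (forall n, 0 <= p n <= 1) ->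
        p n / phat n @[n --> \oo] --> +oo ->
        prob_Gnp (p n) (P n) @[n --> \oo] --> (1 : R)
    & forall p : nat -> R, (forall n, 0 <= p n <= 1) ->
        p n / phat n @[n --> \oo] --> (0 : R) ->
        prob_Gnp (p n) (P n) @[n --> \oo] --> (0 : R)].

End RandomGraph.

(* Main.v *)
Require Import Defs.
From mathcomp Require Import all_boot all_order all_algebra.
From mathcomp Require Import all_classical all_reals all_analysis.
From mathcomp Require Import perm ring lra zify.
Import Order.TTheory GRing.Theory Num.Theory.
Import numFieldNormedType.Exports.
Import mathcomp.boot.fintype mathcomp.boot.finset.

(** Write [p] for the edge probability. All three thresholds are obtained by
    comparing the arrow property with a property not mentioning colourings.

    Two-edge matching against [H1]. A graph that arrows contains [H1], as all
    its edges may be given one colour; conversely, in a copy of [H1] together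
    with a disjoint edge, the absence of a rainbow two-edge matching forces all
    edges of the copy to have the colour of that edge. So the threshold is that
    of containing [H1]: below it the densest subgraph does not appear
    ([subcopy_rare]), above it the second moment method applies
    ([containment]). The copies counted there map each vertex of [H1] into a
    part of its own, which makes them injective automatically and makes two
    copies share exactly the edges between the vertices where they agree.

    Cherry against [H1]. Without a rainbow cherry, colours are constant on
    components, and colouring by components has no rainbow cherry. Hence a
    graph with enough vertices arrows exactly when some component contains all
    edges of a copy of [H1] ([arrow_linked], [linked_of_arrow]). If [H1] is a forest with [k]
    non-isolated vertices, this needs a component with [k] vertices, hence a
    tree on [k] vertices, of which about [n ^ k * p ^ k.-1] are expected
    ([large_component_rare]); and [H1] extends to a tree on these [k] vertices,
    whose own containment threshold is the same. If [H1] contains a cycle, then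
    its density is at least 1, so that above the threshold [p * n] tends to
    infinity. A copy of [H1] is found inside one half of the vertices, and the
    edges between the two halves, which are independent of it, link its
    vertices ([linked_lower]).

    Matching [H1] against a forest [H2] that is not short. Then [H2] contains a
    path on four vertices or a claw ([short_forest_or]). If [p * n] tends to 0,
    the random graph is a forest, and a forest has, for either of the two
    graphs, a colouring without a rainbow copy in which all colour classes are
    stars. If [p * n] tends to infinity, every set of linearly many vertices
    spans an edge. Given a colouring without a monochromatic [H1], each colour
    class is covered by a bounded number of vertices; orienting the edges away
    from these covers, every colour enters a vertex a bounded number of times.
    Since sets with small in-degrees contain large independent sets, few
    vertices are lost when those of small in-degree are discarded repeatedly,
    and a rainbow copy of [H2] is then built greedily ([rainbow_forest]). *)

Set Implicit Arguments.
Unset Strict Implicit.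
Unset Printing Implicit Defensive.

Local Open Scope ring_scope.

(** * The random subset of a finite set *)

Section Bernoulli.
Variables (R : realType) (T : finType) (p : R).
Implicit Types (D E X Y : {set T}) (Q : {set T} -> Prop).

Definition weight E X : R := p ^+ #|X| * (1 - p) ^+ #|E :\: X|.

(** The probability of [Q] for the random subset of [E] containing each element
    independently with probability [p]. *)
Definition Pr E Q : R := \sum_(X in powerset E | `[< Q X >]) weight E X.

Lemma Pr_ext E Q Q' : (forall X, X \subset E -> Q X <-> Q' X) ->
  Pr E Q = Pr E Q'.
Proof.
move=> QQ'; apply: eq_bigl => X; case: (boolP (X \in powerset E)) => //=.
by rewrite powersetE => /QQ' h; apply/asboolP/asboolP => /h.
Qed.

Lemma weight_setU D E X Y : [disjoint D & E] -> X \subset D -> Y \subset E ->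
  weight (D :|: E) (X :|: Y) = weight D X * weight E Y.
Proof.
move=> dDE sXD sYE.
have dXE : [disjoint X & E] by apply: disjointWl dDE.
have dDY : [disjoint D & Y] by apply: disjointWr dDE.
have dXY : [disjoint X & Y] by apply: disjointWl dDY.
rewrite /weight cardsU disjoint_setI0 // cards0 subn0.
have -> : (D :|: E) :\: (X :|: Y) = (D :\: X) :|: (E :\: Y).
  apply/setP => t; rewrite !inE.
  have := disjoint_setI0 dXE; have := disjoint_setI0 dDY.
  move=> /setP/(_ t) + /setP/(_ t); rewrite !inE.
  by case: (t \in D); case: (t \in E); case: (t \in X); case: (t \in Y).
rewrite cardsU disjoint_setI0; last first.
  by apply: disjointWl (subsetDl _ _) _; apply: disjointWr (subsetDl _ _) _.
by rewrite cards0 subn0 !exprD mulrACA.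
Qed.

Lemma sum_powersetU D E (F : {set T} -> R) : [disjoint D & E] ->
  \sum_(X in powerset (D :|: E)) F X =
  \sum_(X in powerset D) \sum_(Y in powerset E) F (X :|: Y).
Proof.
move=> dDE; rewrite pair_big_dep /=.
rewrite (reindex_onto (fun u : {set T} * {set T} => u.1 :|: u.2)
  (fun X => (X :&: D, X :&: E))) /=; last first.
  by move=> X; rewrite powersetE => sX; rewrite -setIUr; apply/setIidPl.
apply: eq_bigl => -[X Y] /=; rewrite !powersetE.
apply/andP/andP => [[sXY /eqP [<- <-]]|[sXD sYE]].
  by rewrite !subsetIr.
split; first by apply: setUSS.
rewrite !setIUl (setIidPl sXD) (setIidPl sYE).
rewrite (disjoint_setI0 (disjointWl sXD dDE)) set0U.
by rewrite setIC (disjoint_setI0 (disjointWr sYE dDE)) setU0.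
Qed.

Lemma weight_sum E : \sum_(X in powerset E) weight E X = 1.
Proof.
have [n] := ubnP #|E|; elim: n E => // n IHn E ltEn.
have [->|[t tE]] := set_0Vmem E.
  by rewrite powerset0 big_set1 /weight setD0 !cards0 mulr1.
have dt : [disjoint [set t] & E :\ t].
  by rewrite disjoints1 !inE eqxx.
rewrite -{1}(setD1K tE) sum_powersetU //.
have powt : powerset [set t] = [set set0; [set t]].
  by apply/setP => X; rewrite powersetE subset1 !inE orbC.
rewrite powt big_setU1 ?big_set1 /=; last first.
  by rewrite inE eq_sym -cards_eq0 cards1.
have IH : \sum_(Y in powerset (E :\ t)) weight (E :\ t) Y = 1.
  by apply: IHn; rewrite (cardsD1 t E) tE in ltEn.
have w X : X \subset [set t] ->
    \sum_(Y in powerset (E :\ t)) weight E (X :|: Y) = weight [set t] X.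
  move=> sX; rewrite -[RHS]mulr1 -[X in _ = _ * X]IH mulr_sumr.
  apply: eq_bigr => Y; rewrite powersetE => sY.
  by rewrite -weight_setU // setD1K.
rewrite !w ?sub0set // /weight cards0 setD0 cards1 setDv cards0.
by rewrite !expr0 !expr1 mul1r mulr1 subrK.
Qed.

Lemma Pr_sure E Q : (forall X, X \subset E -> Q X) -> Pr E Q = 1.
Proof.
move=> hQ; rewrite -(weight_sum E); apply: eq_bigl => X.
by case: (boolP (X \in powerset E)) => //=; rewrite powersetE => /hQ /asboolP.
Qed.

Hypothesis p01 : 0 <= p <= 1.

Lemma weight_ge0 E X : 0 <= weight E X.
Proof. by case/andP: p01 => *; rewrite mulr_ge0 ?exprn_ge0 ?subr_ge0. Qed.

Lemma Pr_ge0 E Q : 0 <= Pr E Q.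
Proof. by apply: sumr_ge0 => X _; apply: weight_ge0. Qed.

Lemma Pr_le E Q Q' : (forall X, X \subset E -> Q X -> Q' X) -> Pr E Q <= Pr E Q'.
Proof.
move=> QQ'; rewrite /Pr big_mkcondr [leRHS]big_mkcondr /= ler_sum // => X.
rewrite powersetE => /QQ' h; have w0 := weight_ge0 E X.
by case: (asboolP (Q X)) => [/h/asboolP -> //|_]; case: ifP.
Qed.

Lemma Pr_le1 E Q : Pr E Q <= 1.
Proof. by rewrite -(@Pr_sure E (fun=> True)) //; apply: Pr_le. Qed.

Lemma PrC E Q : Pr E Q + Pr E (fun X => ~ Q X) = 1.
Proof.
rewrite -(weight_sum E) [RHS](bigID (fun X => `[< Q X >])) /=; congr (_ + _).
by apply: eq_bigl => X; rewrite asbool_neg.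
Qed.

Lemma Pr_bigU (I : Type) (r : seq I) (A : pred I) E Q (Q' : I -> {set T} -> Prop) :
  (forall X, X \subset E -> Q X -> has (fun i => A i && `[< Q' i X >]) r) ->
  Pr E Q <= \sum_(i <- r | A i) Pr E (Q' i).
Proof.
move=> hQ; rewrite /Pr; under [leRHS]eq_bigr do rewrite big_mkcondr /=.
rewrite exchange_big /= big_mkcondr /= ler_sum // => X; rewrite powersetE => sX.
have w0 := weight_ge0 E X.
case: asboolP => [/(hQ _ sX)|_]; last by apply: sumr_ge0 => i _; case: ifP.
elim: r {hQ} => //= i r IHr; rewrite big_cons.
have s0 : 0 <= \sum_(j <- r | A j) (if `[< Q' j X >] then weight E X else 0).
  by apply: sumr_ge0 => j _; case: ifP.
by case: (A i) => //=; case: `[< _ >] => //= => [_|/IHr]; rewrite ?add0r ?lerDl.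
Qed.

Lemma PrU E Q Q1 Q2 : (forall X, X \subset E -> Q X -> Q1 X \/ Q2 X) ->
  Pr E Q <= Pr E Q1 + Pr E Q2.
Proof.
move=> h; have := @Pr_bigU bool [:: true; false] xpredT E Q
  (fun b X => if b then Q1 X else Q2 X).
rewrite big_cons big_seq1 /=; apply=> X sX /(h _ sX) [] /asboolP -> //.
by rewrite orbT.
Qed.

(** Disjoint sets of coordinates are independent: the measure on their union is
    a product, and the sum over it can be iterated. *)
Lemma Pr_setU D E Q : [disjoint D & E] ->
  Pr (D :|: E) Q =
  \sum_(X in powerset D) weight D X * Pr E (fun Y => Q (X :|: Y)).
Proof.
move=> dDE; rewrite /Pr big_mkcondr sum_powersetU //=; apply: eq_bigr => X.
rewrite powersetE => sX; rewrite mulr_sumr [RHS]big_mkcondr /=.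
apply: eq_bigr => Y; rewrite powersetE => sY.
by case: ifP => // _; rewrite weight_setU.
Qed.

Lemma Pr_marginal D E Q : D \subset E -> Pr E (fun X => Q (X :&: D)) = Pr D Q.
Proof.
move=> sDE; rewrite -{1}(setID E D) (setIidPr sDE) Pr_setU; last first.
  by rewrite disjoint_sym disjoints_subset subsetDr.
rewrite /Pr [RHS]big_mkcondr /=; apply: eq_bigr => X; rewrite powersetE => sX.
rewrite (eq_bigl (fun Y => (Y \in powerset (E :\: D)) && `[< Q X >])).
  case: asboolP => _; last by rewrite big_pred0 ?mulr0 // => Y; rewrite andbF.
  by under eq_bigl do rewrite andbT; rewrite weight_sum mulr1.
move=> Y; case: (boolP (Y \in _)) => //=; rewrite powersetE subsetD.
case/andP=> _ dYD; rewrite setIUl (setIidPl sX) (disjoint_setI0 dYD).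
by rewrite setU0.
Qed.

(** Revealing [D1] first and [D2] afterwards: if the first stage succeeds, its
    outcome may be treated as fixed while bounding the failure of the second. *)
Lemma Pr_two_stage E D1 D2 (Q1 : {set T} -> Prop) (Q2 : {set T} -> {set T} -> Prop) (e1 e2 : R) :
  D1 \subset E -> D2 \subset E -> [disjoint D1 & D2] ->
  Pr D1 Q1 <= e1 -> 0 <= e2 ->
  (forall X, X \subset D1 -> ~ Q1 X -> Pr D2 (Q2 X) <= e2) ->
  Pr E (fun X => Q1 (X :&: D1) \/ Q2 (X :&: D1) (X :&: D2)) <= e1 + e2.
Proof.
move=> s1 s2 d12 h1 e20 h2.
pose Q X := Q1 (X :&: D1) \/ Q2 (X :&: D1) (X :&: D2).
rewrite (@Pr_ext _ _ (fun X => Q (X :&: (D1 :|: D2)))); last first.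
  by move=> X _; rewrite /Q -!setIA !(setIC (D1 :|: D2)) setKU setUC setKU.
rewrite Pr_marginal ?subUset ?s1 // Pr_setU //.
rewrite -[e2]mul1r -(weight_sum D1) mulr_suml.
apply: (@le_trans _ _ (Pr D1 Q1 + \sum_(X in powerset D1) weight D1 X * e2)).
  rewrite [Pr D1 Q1]big_mkcondr -big_split /=; apply: ler_sum => X.
  rewrite powersetE => sX; have w0 := weight_ge0 D1 X.
  case: asboolP => [_|nQ]; last first.
    rewrite add0r ler_wpM2l //; apply: le_trans (h2 _ sX nQ).
    apply: Pr_le => Y sY; rewrite /Q.
    have -> : (X :|: Y) :&: D1 = X.
      rewrite setIUl (setIidPl sX) setIC.
      by rewrite (disjoint_setI0 (disjointWr sY d12)) setU0.
    have -> : (X :|: Y) :&: D2 = Y.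
      rewrite setIUl (setIidPl sY).
      by rewrite (disjoint_setI0 (disjointWl sX d12)) set0U.
    by case.
  rewrite -[leLHS]addr0 lerD //; last exact: mulr_ge0.
  by rewrite -[leRHS]mulr1 ler_wpM2l // Pr_le1.
by rewrite lerD2r.
Qed.

Lemma Pr_cylinder E D D' : D \subset E -> D' \subset E -> [disjoint D & D'] ->
  Pr E (fun X => D \subset X /\ [disjoint X & D']) =
  p ^+ #|D| * (1 - p) ^+ #|D'|.
Proof.
move=> sD sD' dDD'.
rewrite (@Pr_ext _ _ (fun X => (fun Y => Y = D) (X :&: (D :|: D')))); last first.
  move=> X sX; split=> [[sDX dX]|e].
    by rewrite setIUr (disjoint_setI0 dX) setU0; apply/setIidPr.
  split; first by rewrite -e subsetIl.
  rewrite -setI_eq0; apply/eqP/setP => t; have /setP/(_ t) := e.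
  rewrite !inE; have /setP/(_ t) := disjoint_setI0 dDD'; rewrite !inE.
  by case: (t \in X); case: (t \in D); case: (t \in D').
rewrite (Pr_marginal (fun Y => Y = D)) ?subUset ?sD // /Pr (big_pred1 D) => [|X /=]; last first.
  rewrite powersetE; case: asboolP => [->|/eqP/negPf ->]; last first.
    by rewrite andbF.
  by rewrite subsetUl eqxx.
rewrite /weight setDUl setDv set0U; congr (_ * _ ^+ #|pred_of_set _|).
by apply/setDidPl; rewrite disjoint_sym.
Qed.

Lemma Pr_superset E D : Pr E (fun X => D \subset X) <= p ^+ #|D|.
Proof.
case: (boolP (D \subset E)) => [sD|nD].
  rewrite -[leRHS]mulr1 -[X in _ * X](expr0 (1 - p)) -(@cards0 T).
  rewrite -(@Pr_cylinder E D set0) ?sub0set //; last first.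
    by rewrite -setI_eq0 setI0.
  by apply: Pr_le => X _ h; split=> //; rewrite -setI_eq0 setI0.
rewrite /Pr big_pred0 ?exprn_ge0 //; first by case/andP: p01.
move=> X; case: (boolP (X \in _)) => //=; rewrite powersetE => sX.
by apply/asboolPn => sD; rewrite (subset_trans sD sX) in nD.
Qed.

Lemma Pr_supersetE E D : D \subset E -> Pr E (fun X => D \subset X) = p ^+ #|D|.
Proof.
move=> sD; have := @Pr_cylinder E D set0 sD (sub0set _).
rewrite cards0 mulr1 => <-; last by rewrite -setI_eq0 setI0.
by apply: Pr_ext => X _; split=> [|[]] //; split=> //; rewrite -setI_eq0 setI0.
Qed.

Lemma Pr_avoid E D : D \subset E ->
  Pr E (fun X => [disjoint X & D]) = (1 - p) ^+ #|D|.
Proof.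
move=> sD; have := @Pr_cylinder E set0 D (sub0set _) sD.
rewrite cards0 mul1r => <-; last by rewrite -setI_eq0 set0I.
by apply: Pr_ext => X _; split=> [|[]] //; rewrite sub0set.
Qed.

Lemma Pr_union_superset (I : finType) (A : pred I) (D : I -> {set T}) E Q d :
  (forall X, X \subset E -> Q X -> exists i, A i /\ D i \subset X) ->
  (forall i, A i -> #|D i| = d) ->
  Pr E Q <= #|A|%:R * p ^+ d.
Proof.
move=> hQ hD.
apply: (@le_trans _ _ (\sum_(i | A i) Pr E (fun X => D i \subset X))).
  apply: Pr_bigU => X sX /(hQ _ sX) [i [Ai sD]]; apply/hasP.
  by exists i; rewrite ?mem_index_enum // Ai; apply/asboolP.
rewrite mulr_natl -sumr_const; apply: ler_sum => i Ai.
by rewrite -(hD i Ai) Pr_superset.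
Qed.

(** Chebyshev's inequality for the number of [i] with [D i \subset X]. *)
Lemma Pr_second_moment (I : finType) (D : I -> {set T}) E d :
  (forall i, D i \subset E) -> (forall i, #|D i| = d) ->
  Pr E (fun X => forall i, ~~ (D i \subset X)) * (#|I|%:R * p ^+ d) ^+ 2 <=
  \sum_i \sum_j (p ^+ #|D i :|: D j| - p ^+ (d + d)).
Proof.
move=> sDE cD; set mu := #|I|%:R * p ^+ d.
(* Evaluate the variance of N, and bound it below by its part where N vanishes. *)
pose N X : R := \sum_i (D i \subset X)%:R.
have Esub D' : D' \subset E ->
    \sum_(X in powerset E) weight E X * (D' \subset X)%:R = p ^+ #|D'|.
  move=> sD'; rewrite -(Pr_supersetE sD') /Pr [RHS]big_mkcondr /=.
  apply: eq_bigr => X _; rewrite asboolb.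
  by case: (_ \subset _); rewrite ?mulr1 ?mulr0.
have EN : \sum_(X in powerset E) weight E X * N X = mu.
  under eq_bigr do rewrite mulr_sumr.
  rewrite exchange_big /= (eq_bigr (fun=> p ^+ d)) => [|i _].
    by rewrite sumr_const /mu mulr_natl.
  by rewrite Esub ?cD.
have EN2 : \sum_(X in powerset E) weight E X * N X ^+ 2 =
    \sum_i \sum_j p ^+ #|D i :|: D j|.
  transitivity (\sum_(X in powerset E) \sum_i \sum_j
      weight E X * (D i :|: D j \subset X)%:R).
    apply: eq_bigr => X _; rewrite expr2 {1}/N mulr_suml mulr_sumr.
    apply: eq_bigr => i _; rewrite mulr_sumr mulr_sumr; apply: eq_bigr => j _.
    by rewrite subUset -natrM mulnb.
  rewrite exchange_big /=; apply: eq_bigr => i _.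
  rewrite exchange_big /=; apply: eq_bigr => j _.
  by rewrite Esub // subUset !sDE.
have -> : \sum_i \sum_j (p ^+ #|D i :|: D j| - p ^+ (d + d)) =
    \sum_(X in powerset E) weight E X * (N X - mu) ^+ 2.
  transitivity (\sum_(X in powerset E) (weight E X * N X ^+ 2
     - 2 * mu * (weight E X * N X) + mu ^+ 2 * weight E X)); last first.
    by apply: eq_bigr => X _; ring.
  rewrite big_split sumrB -!mulr_sumr EN EN2 weight_sum mulr1 /=.
  under eq_bigr do rewrite sumrB.
  rewrite sumrB -addrA; congr (_ + _).
  rewrite sumr_const sumr_const -mulrnA -[_ *+ _]mulr_natl natrM exprD /mu.
  by rewrite expr2; ring.
rewrite /Pr big_mkcondr mulr_suml; apply: ler_sum => X _.
have w0 := weight_ge0 E X.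
case: asboolP => [h|_]; last by rewrite mul0r mulr_ge0 // sqr_ge0.
rewrite /N big1 => [|i _]; first by rewrite sub0r sqrrN.
by rewrite (negPf (h i)).
Qed.

(** The measure depends on cardinalities only, so permutations preserving [E]
    preserve probabilities. *)
Lemma Pr_relabel (s : T -> T) E Q : injective s -> s @: E = E ->
  Pr E (fun X => Q (s @: X)) = Pr E Q.
Proof.
move=> inj_s sE; rewrite /Pr [RHS](reindex_inj (imset_inj inj_s)) /=.
have sub X : (s @: X \subset E) = (X \subset E).
  apply/idP/idP => [|sX]; last by rewrite -sE imsetS.
  rewrite -{1}sE => /subsetP h; apply/subsetP => x xX.
  by rewrite -(mem_imset _ _ inj_s) h // imset_f.
apply: eq_big => X; first by rewrite !powersetE sub.
rewrite powersetE => /andP [sX _]; rewrite /weight card_imset // !cardsD.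
by rewrite (setIidPr sX) (setIidPr _) ?sub // card_imset.
Qed.

End Bernoulli.

(** * Graphs and their copies *)

Definition pairs (W : finType) (A : {set W}) : {set {set W}} :=
  [set e : {set W} | (#|e| == 2%N) && (e \subset A)].

Lemma edge_card (V : finType) (H : sgraph V) e : e \in edges H -> #|e| = 2%N.
Proof. by case: H => E /= /forall_inP h /h /eqP. Qed.

Lemma edges_pairs (V : finType) (H : sgraph V) : edges H \subset pairs setT.
Proof.
by apply/subsetP => e /edge_card eH; rewrite inE eH eqxx subsetT.
Qed.

Lemma pairs_graph (V : finType) (X : {set {set V}}) :
  X \subset pairs setT -> exists H : sgraph V, edges H = X.
Proof.
move=> /subsetP sX.
have h : [forall e in X, #|e| == 2%N].
  by apply/forall_inP => e /sX; rewrite inE => /andP [].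
by exists (SGraph h).
Qed.

Lemma prob_GnpE (R : realType) n (p : R) (P : sgraph 'I_n -> Prop) :
  prob_Gnp p P =
  Pr p (pairs [set: 'I_n]) (fun X => exists2 G, edges G = X & P G).
Proof.
rewrite /Pr (reindex_omap (@edges 'I_n) insub) /=; last first.
  move=> X; rewrite powersetE => /andP [/pairs_graph [H <-] _].
  by rewrite valK.
apply: eq_big => [G|G _].
  rewrite valK eqxx andbT powersetE edges_pairs /=.
  apply/asboolP/asboolP => [PG|[G' /val_inj <-]] //.
  by exists G.
rewrite /weight cardsD (setIidPr (edges_pairs G)) /num_edges.
have -> // : #|pairs [set: 'I_n]| = 'C(n, 2).
rewrite -[in RHS](card_ord n) -card_draws; apply: eq_card => e.
by rewrite !inE subsetT andbT.
Qed.

Section Graph.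
Variables (V : finType) (H : sgraph V).

Lemma adj_sym : symmetric (adj H).
Proof. by move=> u v; rewrite /adj setUC. Qed.

Lemma adj_neq u v : adj H u v -> u != v.
Proof.
by rewrite /adj => /edge_card; rewrite cards2; case: (u != v).
Qed.

Lemma edge_adj e : e \in edges H -> exists u v, e = [set u; v] /\ adj H u v.
Proof.
move=> eH; have /eqP/cards2P [u [v [_ ee]]] := edge_card eH.
by exists u, v; rewrite /adj -ee.
Qed.

Lemma edge_nonisolated e : e \in edges H -> e \subset nonisolated H.
Proof.
move=> /edge_adj [u [v [-> auv]]]; rewrite subUset !sub1set !inE.
by apply/andP; split; apply/existsP; [exists v|exists u; rewrite adj_sym].
Qed.

End Graph.

Lemma extend_inj (V W : finType) (S : {set V}) (f : V -> W) :
  {in S &, injective f} -> (#|V| <= #|W|)%N ->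
  exists g : V -> W, injective g /\ {in S, g =1 f}.
Proof.
move=> injf leVW.
have [n] := ubnP #|~: S|; elim: n S f injf => // n IHn S f injf ltn.
have [S0|[v]] := set_0Vmem (~: S).
  have allS x : x \in S by move/setP/(_ x): S0; rewrite !inE => /negbFE.
  by exists f; split=> // x y; apply: injf.
rewrite inE => vS.
have [w] : exists w, w \notin f @: S.
  apply/existsP; rewrite -negb_forall; apply/negP => /forallP h.
  have : (#|W| <= #|f @: S|)%N.
    by rewrite -cardsT; apply: subset_leq_card; apply/subsetP.
  rewrite card_in_imset // => leWS.
  have := cardsC S; rewrite (cardsD1 v (~: S)) inE vS /= => e.
  by have := leq_trans leVW leWS; rewrite -e; lia.
move=> wS; pose f' x := if x == v then w else f x.
have f'S : {in S, f' =1 f}.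
  by move=> x xS; rewrite /f'; case: eqP => // e; rewrite -e xS in vS.
have [||g [injg gf]] := IHn (v |: S) f'.
- move=> x y; rewrite !inE => /orP [/eqP ->|xS] /orP [/eqP ->|yS] //.
  + rewrite (f'S y yS) /f' eqxx => e; case/negP: wS.
    by rewrite e imset_f.
  + rewrite (f'S x xS) /f' eqxx => e; case/negP: wS.
    by rewrite -e imset_f.
  + by rewrite !f'S //; apply: injf.
- rewrite setCU; move: ltn; rewrite (cardsD1 v (~: S)) inE vS /=.
  by rewrite setIC -setDE.
exists g; split=> // x xS; rewrite gf ?f'S //.
by rewrite !inE xS orbT.
Qed.

Lemma extend_copy (V W : finType) (H : sgraph V) (G : sgraph W) (f : V -> W) :
  {in nonisolated H &, injective f} ->
  (forall e, e \in edges H -> f @: e \in edges G) ->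
  (#|V| <= #|W|)%N ->
  exists g, is_copy G H g /\ forall e, e \in edges H -> g @: e = f @: e.
Proof.
move=> injf fe leVW; have [g [injg gf]] := extend_inj injf leVW.
have ge e : e \in edges H -> g @: e = f @: e.
  move=> /edge_nonisolated/subsetP sub.
  by apply: eq_in_imset => x /sub/gf.
by exists g; split=> //; split=> // e eH; rewrite ge ?fe.
Qed.

Definition inside (V : finType) (H : sgraph V) (S : {set V}) : {set {set V}} :=
  [set e in edges H | e \subset S].

(** * Orderings of forests *)

Section Forest.
Variables (V : finType) (H : sgraph V).
Hypothesis forestH : is_forest H.

(** Otherwise every vertex of [N] has two neighbours in [N]. A path in [N] can
    then always be extended at its head, as a neighbour of the head lying beyond
    the second vertex of the path would close a cycle; but paths are no longer
    than [#|V|]. *)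
Lemma forest_leaf (N : {set V}) : N != set0 ->
  exists2 v, v \in N &
    forall u w, u \in N -> w \in N -> adj H v u -> adj H v w -> u = w.
Proof.
case/set0Pn=> v0 v0N; apply: contrapT => noleaf.
have deg2 v : v \in N -> exists u w,
    [/\ u \in N, w \in N, adj H v u, adj H v w & u != w].
  move=> vN; apply: contrapT => h; apply: noleaf; exists v => // u w uN wN vu vw.
  by apply/eqP/negPn/negP => uw; apply: h; exists u, w.
have long n : exists x s,
    [/\ size s = n, uniq (x :: s), path (adj H) x s & x \in N].
  elim: n => [|n [x [s [sz un px xN]]]]; first by exists v0, [::].
  have [u [w [uN wN xu xw uw]]] := deg2 x xN.
  have {u w uN wN xu xw uw} [z [zN xz zs]] :
      exists z, [/\ z \in N, adj H x z & ohead s != Some z].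
    case: (eqVneq (ohead s) (Some u)) => [e|]; last by exists u.
    by exists w; split=> //; rewrite e; apply: contraNneq uw => -[->].
  have [zin|zout] := boolP (z \in x :: s); last first.
    exists z, (x :: s); rewrite [size _]/= sz; split=> //; first by rewrite cons_uniq zout.
    by rewrite /= adj_sym xz.
  move: zin; rewrite inE eq_sym (negPf (adj_neq xz)) /= => zin.
  case/splitPr: zin un px zs sz => s1 s2 un px zs _.
  suff : ucycle (adj H) (x :: rcons s1 z).
    move/forestH; case: s1 {un px} zs => [|a s1] /=; first by rewrite eqxx.
    by rewrite size_rcons.
  rewrite /ucycle /cycle rcons_path last_rcons adj_sym xz andbT.
  rewrite -cat_rcons in un px.
  move: px; rewrite cat_path => /andP [-> _] /=.
  by move: un; rewrite -cat_cons cat_uniq => /andP [].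
have [x [s [sz un _ _]]] := long #|V|.
have := card_uniqP un; rewrite /= sz => e.
by have := max_card [in x :: s]; rewrite e ltnn.
Qed.

(** A forest on [N] can be grown one vertex at a time, the [i]-th vertex being
    joined to at most one earlier vertex, the [j i]-th one. *)
Lemma forest_order (v0 : V) (N : {set V}) : exists (s : seq V) (j : nat -> nat),
  [/\ uniq s, s =i N, forall i, (0 < i)%N -> (j i < i)%N &
      forall a b, (a < b < size s)%N -> adj H (nth v0 s a) (nth v0 s b) -> a = j b].
Proof.
have [n] := ubnP #|N|; elim: n N => // n IHn N ltn.
have [->|N0] := eqVneq N set0.
  exists [::], predn; split=> //; first by move=> v; rewrite !inE.
    by case.
  by move=> a b; rewrite ltn0 andbF.
have [v vN leafv] := forest_leaf N0.
have [|s [j [un sN ltj js]]] := IHn (N :\ v).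
  by move: ltn; rewrite (cardsD1 v N) vN.
have vs : v \notin s by rewrite sN !inE eqxx.
(* The leaf v comes last, with its neighbour, if it has one, as parent. *)
pose nb := [pred u | adj H v u].
exists (rcons s v).
exists (fun i => if i == size s then (if has nb s then find nb s else 0%N) else j i).
split.
- by rewrite rcons_uniq vs.
- move=> x; rewrite mem_rcons inE sN !inE.
  by case: eqP => // ->.
- move=> i i0; case: eqP => [ei|_]; last exact: ltj.
  by case: ifP => // hs; rewrite ei -has_find.
move=> a b /andP [ltab]; rewrite size_rcons ltnS leq_eqVlt => /orP [/eqP eb|ltb].
  rewrite eb !nth_rcons ltnn eqxx in ltab *.
  rewrite ltab => av.
  have aN : nth v0 s a \in N.
    have : nth v0 s a \in s by rewrite mem_nth.
    by rewrite sN inE => /andP [].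
  have hasnb : has nb s.
    by apply/hasP; exists (nth v0 s a); rewrite ?mem_nth //= adj_sym.
  rewrite hasnb; apply/eqP; rewrite -(nth_uniq v0 _ _ un) -?has_find //.
  have nbs : find nb s \in [pred i | (i < size s)%N] by rewrite inE -has_find.
  apply/eqP/leafv => //; last 2 first.
  - by rewrite adj_sym.
  - exact: (nth_find v0 hasnb).
  have : nth v0 s (find nb s) \in s by rewrite mem_nth.
  by rewrite sN inE => /andP [].
rewrite !nth_rcons ltb (ltn_trans ltab ltb) (ltn_eqF ltb).
by apply: js; rewrite ltab.
Qed.

End Forest.

(** The colours alternate along parents; the recursion on [j i < i] is run with
    fuel. *)
Lemma parity_coloring (j : nat -> nat) :
  (forall i, (0 < i)%N -> (j i < i)%N) ->
  exists col : nat -> bool, forall i, (0 < i)%N -> col i = ~~ col (j i).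
Proof.
move=> ltj.
pose c := fix c n i := if n is m.+1 then
   (if i == 0%N then true else ~~ c m (j i)) else true.
have cE n m i : (i < n)%N -> (i < m)%N -> c n i = c m i.
  elim: n m i => // n IHn [] // m i /= ltn ltm; case: eqP => // /eqP i0.
  have lt := ltj i; rewrite -lt0n in i0.
  by rewrite (IHn m) //; apply: leq_trans (lt i0) _.
exists (fun i => c i.+1 i) => i i0 /=.
rewrite gtn_eqF // (cE i (j i).+1) ?ltj //=.
Qed.

(** * Trees and components *)

Section TreeEdges.
Variables (W : finType) (x : nat -> W) (j : nat -> nat) (k : nat).

Definition tree_edges : {set {set W}} :=
  [set [set x i.+1; x (j i.+1)] | i : 'I_k.-1].

Hypothesis injx : {in gtn k &, injective x}.
Hypothesis ltj : forall i, (0 < i)%N -> (j i < i)%N.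

(** If [a < b], then [x b] would be one of [x a] and [x (j a)], which come earlier. *)
Lemma tree_edge_inj a b : (0 < a < k)%N -> (0 < b < k)%N ->
  [set x a; x (j a)] = [set x b; x (j b)] -> a = b.
Proof.
wlog leab : a b / (a <= b)%N.
  move=> wlg ha hb e; case/orP: (leq_total a b) => h; first exact: wlg.
  by apply/esym/wlg.
move=> /andP [a0 ak] /andP [b0 bk] e.
have : x b \in [set x a; x (j a)] by rewrite e !inE eqxx.
have ja := ltn_trans (ltj a0) ak.
rewrite !inE => /orP [] /eqP /injx; rewrite !inE => /(_ bk) h; first by rewrite h.
by have := ltj a0; rewrite -h // ltnNge leab.
Qed.

Lemma card_tree_edges : #|tree_edges| = k.-1.
Proof.
rewrite card_imset ?card_ord // => a b e; apply/val_inj.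
suff : a.+1 = b.+1 by case.
by apply: tree_edge_inj e; rewrite /= -ltn_predRL ltn_ord.
Qed.

(** Charge every edge to its later endpoint: the earliest vertex in [S] is never
    charged. *)
Lemma tree_edges_inside (S : {set W}) :
  (#|[set e in tree_edges | e \subset S]| <=
   #|[set i : 'I_k | x i \in S]|.-1)%N.
Proof.
set A := [set i : 'I_k | x i \in S].
have [e0|[e]] := set_0Vmem [set e in tree_edges | e \subset S].
  by rewrite e0 cards0.
rewrite inE => /andP [/imsetP [i _ ->]]; rewrite subUset !sub1set => /andP [iS _].
have ik : (i.+1 < k)%N by rewrite -ltn_predRL.
have iA : Ordinal ik \in A by rewrite inE.
pose m := [arg min_(i < Ordinal ik in A) val i]%N.
have [mA minm] : m \in A /\ forall i, i \in A -> (m <= i)%N.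
  by rewrite /m; case: arg_minnP.
suff /subset_leq_card h : [set e in tree_edges | e \subset S] \subset
    (fun i : 'I_k => [set x i; x (j i)]) @: (A :\ m).
  by apply: leq_trans h (leq_trans (leq_imset_card _ _) _); rewrite (cardsD1 m A) mA.
apply/subsetP => f; rewrite inE => /andP [/imsetP [a _ ->]].
rewrite subUset !sub1set => /andP [aS jaS].
have ak : (a.+1 < k)%N by rewrite -ltn_predRL.
have jak := ltn_trans (ltj (ltn0Sn a)) ak.
apply/imsetP; exists (Ordinal ak) => //; rewrite !inE aS andbT.
apply/eqP => /(congr1 val) /= em; have := minm (Ordinal jak).
by rewrite inE => /(_ jaS) /=; rewrite -em leqNgt ltj.
Qed.

End TreeEdges.

Definition linked (W : finType) (X : {set {set W}}) : rel W :=
  connect (fun u v => [set u; v] \in X).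

Lemma linked_sym (W : finType) (X : {set {set W}}) : symmetric (linked X).
Proof. by apply: sym_connect_sym => u v; rewrite setUC. Qed.

Lemma linkedS (W : finType) (X Y : {set {set W}}) u v : X \subset Y ->
  linked X u v -> linked Y u v.
Proof.
move=> /subsetP sXY; apply: connect_sub => a b /sXY.
exact: connect1.
Qed.

Section TreeSpan.
Variables (W : finType) (X : {set {set W}}).

Lemma tree_linked (x : nat -> W) j k :
  (forall i, (0 < i)%N -> (j i < i)%N) -> tree_edges x j k \subset X ->
  forall a b, (a < k)%N -> (b < k)%N -> linked X (x a) (x b).
Proof.
move=> ltj /subsetP sX.
suff h a : (a < k)%N -> linked X (x 0%N) (x a).
  by move=> a b /h ha /h; apply: connect_trans; rewrite [connect _ _ _]linked_sym.
elim/ltn_ind: a => -[|a] IHa lta; first exact: connect0.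
have lt := ltj a.+1 (ltn0Sn a).
apply: connect_trans (IHa _ lt (ltn_trans lt lta)) _; apply: connect1.
rewrite setUC; apply: sX; apply/imsetP.
have ak : (a < k.-1)%N by rewrite ltn_predRL.
by exists (Ordinal ak).
Qed.

(** Repeatedly add an edge leaving the current vertex set: there is one on any
    path to a vertex of the component not yet reached. *)
Lemma linked_tree (w : W) k : (0 < k)%N -> (k <= #|[set u | linked X w u]|)%N ->
  exists (x : nat -> W) (j : nat -> nat),
  [/\ {in gtn k &, injective x}, forall i, (0 < i)%N -> (j i < i)%N &
      tree_edges x j k \subset X].
Proof.
set C := [set u | _]; move=> k0 leC.
suff: exists (x : nat -> W) (j : nat -> nat),
  [/\ {in gtn k &, injective x}, forall i, (0 < i)%N -> (j i < i)%N,
      tree_edges x j k \subset X & forall i, (i < k)%N -> x i \in C].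
  by case=> x [j [? ? ? _]]; exists x, j.
elim: k k0 leC => // -[_ _ _|k IHk _ leC].
  exists (fun=> w), predn; split=> //.
  - by move=> a b; rewrite !inE !ltnS !leqn0 => /eqP -> /eqP ->.
  - by case.
  - by apply/subsetP => e /imsetP [[]].
  - by move=> i _; rewrite inE; apply: connect0.
have [//||x [j [injx ltj sX xC]]] := IHk; first exact: ltnW.
pose S := [set x (val i) | i : 'I_k.+1].
have cS : #|S| = k.+1.
  rewrite card_in_imset ?card_ord // => a b _ _ /injx h.
  by apply/val_inj/h; rewrite inE ltn_ord.
have SC : S \subset C by apply/subsetP => u /imsetP [i _ ->]; exact: xC (ltn_ord i).
have [u uC uS] : exists2 u, u \in C & u \notin S.
  apply/subsetPn; apply/negP => /subset_leq_card; rewrite cS => h.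
  by have := leq_trans leC h; rewrite ltnn.
have x0S : x 0%N \in S by apply/imsetP; exists ord0.
have : linked X (x 0%N) u.
  have := subsetP SC _ x0S; move: uC; rewrite !inE => wu wx.
  by apply: connect_trans wu; rewrite [connect _ _ _]linked_sym.
case/connectP => q; elim: q (x 0%N) x0S => [|b q IHq] a aS /=.
  by move=> _ e; rewrite e aS in uS.
move=> /andP [ab pq] e; have [bS|bS] := boolP (b \in S); first exact: (IHq b).
have bC : b \in C.
  have := subsetP SC _ aS; rewrite !inE => wa.
  by apply: connect_trans wa (connect1 _).
case/imsetP: aS => i _ ai.
exists (fun m => if m == k.+1 then b else x m).
exists (fun m => if m == k.+1 then val i else j m); split.
- have bx m : (m < k.+1)%N -> b <> x m.
    by move=> lt eb; case/negP: bS; apply/imsetP; exists (Ordinal lt).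
  move=> m m'; rewrite !inE (ltnS _ k.+1) (ltnS _ k.+1) leq_eqVlt.
  case: eqP => [-> _|_ /= ltm].
    by rewrite leq_eqVlt; case: eqP => [-> //|_ /= /bx].
  rewrite leq_eqVlt; case: eqP => [_ _ /esym /bx|_ /= ltm' ]; first by move/(_ ltm).
  by apply: injx; rewrite inE.
- by move=> m m0; case: eqP => [->|_]; [exact: ltn_ord|exact: ltj].
- apply/subsetP => f /imsetP [m _ ->].
  have := ltn_ord m; rewrite [X in (_ < X)%N]/= ltnS leq_eqVlt => /orP [/eqP em|ltm].
    have ik : (val i == k.+1) = false by rewrite ltn_eqF // ltn_ord.
    by rewrite em eqxx ik setUC -ai.
  have m1 : (m.+1 < k.+1)%N by [].
  rewrite (ltn_eqF m1) (ltn_eqF (ltn_trans (ltj _ (ltn0Sn m)) m1)).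
  by apply: (subsetP sX); apply/imsetP; exists (Ordinal ltm).
- by move=> m mk; case: eqP => // /eqP ne; apply: xC; lia.
Qed.

End TreeSpan.

(** * Colourings without a rainbow matching or cherry *)

Lemma nonisolatedE (V : finType) (H : sgraph V) : nonisolated H = cover (edges H).
Proof.
apply/setP => v; rewrite inE; apply/existsP/bigcupP => [[w vw]|[e eH ve]].
  by exists [set v; w] => //; rewrite !inE eqxx.
have [a [b [ee ab]]] := edge_adj eH; move: ve; rewrite ee !inE.
by case/orP => /eqP ->; [exists b|exists a; rewrite adj_sym].
Qed.

(** Embeddings of matchings can be extended edge by edge. *)
Lemma add_edge (V W : finType) (D : {set {set V}}) (f : V -> W)
    (e : {set V}) (e' : {set W}) :
  {in cover D &, injective f} -> #|e| = 2%N -> #|e'| = 2%N ->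
  [disjoint e & cover D] -> [disjoint e' & f @: cover D] ->
  exists g : V -> W, [/\ {in cover (e |: D) &, injective g}, g @: e = e' &
    {in cover D, g =1 f}].
Proof.
move=> injf /eqP/cards2P [a [b [ab ->]]] /eqP/cards2P [u [v [uv ->]]] de de'.
pose g x := if x == a then u else if x == b then v else f x.
have ga : g a = u by rewrite /g eqxx.
have gb : g b = v by rewrite /g eqxx eq_sym (negPf ab).
have aD : a \notin cover D.
  by move/disjoint_setI0/setP/(_ a): de; rewrite !inE eqxx /= => ->.
have bD : b \notin cover D.
  by move/disjoint_setI0/setP/(_ b): de; rewrite !inE eqxx orbT /= => ->.
have uD : u \notin f @: cover D.
  by move/disjoint_setI0/setP/(_ u): de'; rewrite !inE eqxx /= => ->.
have vD : v \notin f @: cover D.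
  by move/disjoint_setI0/setP/(_ v): de'; rewrite !inE eqxx orbT /= => ->.
have gD : {in cover D, g =1 f}.
  move=> x xD; rewrite /g; case: eqP => [ex|_]; first by rewrite -ex xD in aD.
  by case: eqP => // ex; rewrite -ex xD in bD.
have ufD x : x \in cover D -> u <> f x.
  by move=> xD ex; case/negP: uD; rewrite ex imset_f.
have vfD x : x \in cover D -> v <> f x.
  by move=> xD ex; case/negP: vD; rewrite ex imset_f.
exists g; split => //; last by rewrite imsetU1 imset_set1 ga gb.
have -> : cover ([set a; b] |: D) = [set a; b] :|: cover D.
  by rewrite /cover bigcup_setU big_set1.
move=> x y; rewrite !inE -!orbA.
case/or3P=> [/eqP ->|/eqP ->|xD]; case/or3P=> [/eqP ->|/eqP ->|yD] //;
  rewrite ?ga ?gb ?gD // => exy.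
- by rewrite exy eqxx in uv.
- by case: (ufD y yD).
- by rewrite exy eqxx in uv.
- by case: (vfD y yD).
- by case: (ufD x xD).
- by case: (vfD x xD).
- exact: injf.
Qed.

(** A maximal partial embedding of a matching meets every edge of [Y]. *)
Lemma matching_or_cover (V W : finType) (E : {set {set V}}) (Y : {set {set W}}) (w : W) :
  trivIset E -> (forall e, e \in E -> #|e| = 2%N) ->
  (forall e, e \in Y -> #|e| = 2%N) ->
  (exists f : V -> W, {in cover E &, injective f} /\
     forall e, e \in E -> f @: e \in Y) \/
  (exists C : {set W}, (#|C| <= 2 * #|E|)%N /\
     forall e, e \in Y -> ~~ [disjoint e & C]).
Proof.
have [n] := ubnP #|E|; elim: n E => // n IHn E ltn tE E2 Y2.
have [E0|[e eE]] := set_0Vmem E.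
  left; exists (fun=> w); rewrite E0; split.
    by move=> x y; rewrite /cover big_set0 inE.
  by move=> e; rewrite inE.
have cE : #|E| = (#|E :\ e|).+1 by rewrite (cardsD1 e E) eE.
have [||e1 e1E||[f [injf fY]]|[C [leC CY]]] := IHn (E :\ e); last 1 first.
- by right; exists C; split=> //; apply: leq_trans leC _; rewrite cE; lia.
- by rewrite -ltnS -cE.
- by apply: trivIsetS tE; apply: subsetDl.
- by apply: E2; move: e1E; rewrite inE => /andP [].
- exact: Y2.
(* Either the image of the partial embedding is a cover, or a disjoint edge of Y
   extends the embedding to e. *)
have [h|] := boolP [forall e' in Y, ~~ [disjoint e' & f @: cover (E :\ e)]].
  right; exists (f @: cover (E :\ e)); split; last exact/forall_inP.
  rewrite card_in_imset // (leq_trans (leq_card_cover _)) //.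
  rewrite (eq_bigr (fun=> 2%N)) => [|e1]; last first.
    by rewrite inE => /andP [_ /E2].
  by rewrite sum_nat_const mulnC leq_mul2l /= subset_leq_card // subsetDl.
rewrite negb_forall_in => /existsP [e' /andP [e'Y /negPn de']].
have de : [disjoint e & cover (E :\ e)].
  apply/bigcup_disjointP => e1; rewrite !inE => /andP [ne e1E].
  by apply: (trivIsetP tE) => //; rewrite eq_sym.
have [g [injg ge gf]] := add_edge injf (E2 e eE) (Y2 e' e'Y) de de'.
left; exists g; rewrite setD1K // in injg; split=> // e1 e1E.
have [->|ne] := eqVneq e1 e; first by rewrite ge.
have e1D : e1 \in E :\ e by rewrite !inE ne.
suff -> : g @: e1 = f @: e1 by apply: fY.
by apply: eq_in_imset => x xe1; apply: gf; apply/bigcupP; exists e1.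
Qed.

Section Arrow.
Variables (V1 V2 W : finType) (H1 : sgraph V1) (H2 : sgraph V2) (G : sgraph W).

(** A constant colouring has no rainbow copy of a graph with two edges. *)
Lemma arrow_contains : (1 < num_edges H2)%N -> mr_arrow G H1 H2 ->
  exists f : V1 -> W, is_copy G H1 f.
Proof.
move=> /card_gt1P [e [e' [eH e'H ne]]] /(_ (fun=> 0%N)) [[f [fH _]]|[f [_ h]]].
  by exists f.
by case: (h e e').
Qed.

(** If an edge of the copy of [H1] had another colour than the disjoint edge [e0],
    the two would form a rainbow copy of [H2]. *)
Lemma arrow_two_matching (f : V1 -> W) (e0 : {set W}) :
  is_matching H2 -> num_edges H2 = 2%N -> (#|V2| <= #|W|)%N ->
  is_copy G H1 f -> e0 \in edges G ->
  (forall e, e \in edges H1 -> [disjoint e0 & f @: e]) -> mr_arrow G H1 H2.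
Proof.
move=> mH /eqP/cards2P [e1 [e2 [ne E2]]] leV [injf fH] e0G dis c.
have e1H : e1 \in edges H2 by rewrite E2 !inE eqxx.
have e2H : e2 \in edges H2 by rewrite E2 !inE eqxx orbT.
have d12 : [disjoint e1 & e2] by apply: (trivIsetP mH).
have [rb|norb] := pselect (rainbow_copy G c H2); [by right|left].
suff ce e : e \in edges H1 -> c (f @: e) = c e0.
  by exists f; split=> // e e' /ce -> /ce ->.
move=> eH; apply: contrapT => nc; apply: norb.
have cov0 : cover (set0 : {set {set V2}}) = set0 by rewrite /cover big_set0.
have /card_gt0P [u _] : (0 < #|e0|)%N by rewrite (edge_card e0G).
have [|||||g1 [inj1 ge1 _]] := @add_edge _ _ set0 (fun=> u) e2 e0.
- by move=> x y; rewrite cov0 inE.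
- exact: edge_card e2H.
- exact: edge_card e0G.
- by rewrite cov0 -setI_eq0 setI0.
- by rewrite cov0 imset0 -setI_eq0 setI0.
have cov1 : cover (e2 |: set0) = e2 by rewrite setU0 /cover big_set1.
have [||||g [inj2 ge gg1]] := @add_edge _ _ _ _ e1 (f @: e) inj1.
- exact: edge_card e1H.
- exact: edge_card (fH _ eH).
- by rewrite cov1.
- by rewrite cov1 ge1 disjoint_sym dis.
have ge2 : g @: e2 = e0.
  by rewrite -ge1; apply: eq_in_imset => x xe; apply: gg1; rewrite cov1.
have [||g' [g'H g'g]] := @extend_copy _ _ H2 G g _ _ leV.
- by rewrite nonisolatedE E2 -[[set e2]]setU0.
- by move=> d; rewrite E2 !inE => /orP [] /eqP ->; rewrite ?ge ?ge2 // fH.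
exists g'; split=> // d d' dH d'H; rewrite !g'g //.
by move: dH d'H; rewrite E2 !inE => /orP [] /eqP -> /orP [] /eqP ->;
  rewrite ?eqxx ?ge ?ge2 // => _ // /esym.
Qed.

Hypothesis cherry2 : is_cherry H2.

(** If two edges at a common vertex had different colours they would form a
    rainbow cherry; so colours are constant on components. *)
Lemma arrow_linked (f : V1 -> W) :
  (#|V2| <= #|W|)%N -> is_copy G H1 f ->
  {in nonisolated H1 &, forall u v, linked (edges G) (f u) (f v)} ->
  mr_arrow G H1 H2.
Proof.
case: cherry2 => x [y [z [un E2]]] leV [injf fH] lk c.
have [rb|norb] := pselect (rainbow_copy G c H2); [by right|left].
have neq : [/\ x != y, x != z & y != z].
  by move: un; rewrite /= !inE negb_or => /andP [/andP [-> ->]] /andP [->].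
case: neq => xy xz yz.
have mono a b b' : [set a; b] \in edges G -> [set a; b'] \in edges G ->
    c [set a; b] = c [set a; b'].
  move=> ab ab'; have [->//|bb'] := eqVneq b b'.
  apply: contrapT => nc; apply: norb.
  have nab : a != b by apply: adj_neq ab.
  have nab' : a != b' by apply: adj_neq ab'.
  pose g v := if v == x then a else if v == y then b else b'.
  have gx : g x = a by rewrite /g eqxx.
  have gy : g y = b by rewrite /g eqxx eq_sym (negPf xy).
  have gz : g z = b'.
    by rewrite /g eq_sym (negPf xz) eq_sym (negPf yz).
  have gxy : g @: [set x; y] = [set a; b] by rewrite imsetU1 imset_set1 gx gy.
  have gxz : g @: [set x; z] = [set a; b'] by rewrite imsetU1 imset_set1 gx gz.
  have [||g' [g'H g'g]] := @extend_copy _ _ H2 G g _ _ leV.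
  - rewrite nonisolatedE E2 /cover bigcup_setU !big_set1 => u v; rewrite !inE -!orbA.
    by case/or4P=> /eqP -> /or4P [] /eqP ->; rewrite ?gx ?gy ?gz // => e;
      move: nab nab' bb'; rewrite e ?eqxx.
  - by move=> d; rewrite E2 !inE => /orP [] /eqP ->; rewrite ?gxy ?gxz.
  exists g'; split=> // d d' dH d'H; rewrite !g'g //.
  by move: dH d'H; rewrite E2 !inE => /orP [] /eqP -> /orP [] /eqP ->;
    rewrite ?eqxx ?gxy ?gxz // => _ // /esym.
have mono2 u v b b' : linked (edges G) u v -> [set u; b] \in edges G ->
    [set v; b'] \in edges G -> c [set u; b] = c [set v; b'].
  case/connectP => p; elim: p u b => [|w p IHp] u b /=.
    by move=> _ -> ub vb'; apply: mono.
  move=> /andP [uw pp] ev ub vb'; rewrite (mono u b w ub uw) setUC.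
  by apply: IHp => //; rewrite setUC.
exists f; split=> // e e' eH e'H.
have [a [b [ee ab]]] := edge_adj eH.
have [a' [b' [ee' ab']]] := edge_adj e'H.
have := fH _ eH; have := fH _ e'H.
rewrite ee ee' !imsetU1 !imset_set1 => h' h; apply: mono2 => //.
by apply: lk; rewrite inE; apply/existsP; [exists b|exists b'].
Qed.

(** Colouring every edge by its component avoids rainbow cherries, so it has a
    monochromatic copy of [H1]. *)
Lemma linked_of_arrow : mr_arrow G H1 H2 ->
  exists f : V1 -> W, is_copy G H1 f /\
  {in nonisolated H1 &, forall u v, linked (edges G) (f u) (f v)}.
Proof.
pose r := fingraph.root (fun u v : W => [set u; v] \in edges G).
pose c (e : {set W}) : nat :=
  if [pick u in e] is Some u then enum_rank (r u) else 0%N.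
have csym : connect_sym (fun u v : W => [set u; v] \in edges G).
  by apply: sym_connect_sym => u v; rewrite setUC.
have cE a b : [set a; b] \in edges G -> c [set a; b] = enum_rank (r a).
  move=> ab; rewrite /c; case: pickP => [u|/(_ a)]; last by rewrite !inE eqxx.
  rewrite !inE => /orP [] /eqP -> //; congr (nat_of_ord (enum_rank _)).
  by apply/eqP; rewrite root_connect // csym connect1.
case/(_ c) => [[f [fH mono]]|[f [[injf fH] rb]]].
  exists f; split=> // u v; rewrite !inE => /existsP [u' uu'] /existsP [v' vv'].
  have := mono _ _ uu' vv'; case: fH => _ fH.
  have := fH _ uu'; have := fH _ vv'; rewrite !imsetU1 !imset_set1.
  by move=> hv hu; rewrite !cE // => /ord_inj/enum_rank_inj/eqP; rewrite root_connect.
case: cherry2 => x [y [z [un E2]]].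
have yz : [set x; y] != [set x; z].
  move: un; rewrite /= !inE negb_or => /andP [/andP [xy xz]] /andP [yz _].
  apply/eqP => /setP/(_ y); rewrite !inE eqxx orbT eq_sym (negPf xy) /=.
  by rewrite (negPf yz).
have xyH : [set x; y] \in edges H2 by rewrite E2 !inE eqxx.
have xzH : [set x; z] \in edges H2 by rewrite E2 !inE eqxx orbT.
case: (rb _ _ xyH xzH yz); have := fH _ xyH; have := fH _ xzH.
by rewrite !imsetU1 !imset_set1 => h h'; rewrite !cE.
Qed.

End Arrow.

(** * Colourings of forests *)

Lemma adj_share (V : finType) (H : sgraph V) e x :
  e \in edges H -> x \in e -> exists y, [/\ e = [set x; y], adj H x y & x != y].
Proof.
move=> eH; have [a [b [ee ab]]] := edge_adj eH.
have nab := adj_neq ab; rewrite ee !inE => /orP [] /eqP ->; first by exists b.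
by exists a; rewrite setUC adj_sym eq_sym.
Qed.

Definition has_path4 (V : finType) (H : sgraph V) :=
  exists a b c d, [/\ uniq [:: a; b; c; d], adj H a b, adj H b c & adj H c d].

Definition has_claw (V : finType) (H : sgraph V) :=
  exists x a b c, [/\ uniq [:: a; b; c], adj H x a, adj H x b & adj H x c].

Lemma set2_inj (V : finType) (x y z : V) : [set x; y] = [set x; z] -> x != y -> y = z.
Proof.
move=> /setP/(_ y); rewrite !inE eqxx orbT => /esym/orP [] /eqP // -> .
by rewrite eqxx.
Qed.

(** Without a path on four vertices, meeting is an equivalence relation on the
    edges; without a claw or a triangle its classes are edges and cherries. *)
Lemma short_forest_or (V : finType) (H : sgraph V) :
  is_forest H -> ~ is_short_forest H -> has_path4 H \/ has_claw H.
Proof.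
move=> forestH; apply: contra_notP => /not_orP [noP noK].
pose R := fun e e' : {set V} => ~~ [disjoint e & e'].
have RP (e e' : {set V}) : reflect (exists2 x, x \in e & x \in e') (R e e').
  rewrite /R; apply: (iffP idP) => [|[x xe xe']].
    by rewrite -setI_eq0 => /set0Pn [x]; rewrite inE => /andP [*]; exists x.
  by rewrite -setI_eq0; apply/set0Pn; exists x; rewrite inE xe.
have Rxx : {in edges H, reflexive R}.
  move=> e eH; have /card_gt0P [u ue] : (0 < #|e|)%N by rewrite (edge_card eH).
  by apply/RP; exists u.
have Rtr : {in edges H & &, forall e e' e'', R e e' -> R e' e'' -> R e e''}.
  move=> e e' e'' eH e'H e''H /RP [u ue ue'] /RP [v ve' ve''].
  have [uv|uv] := eqVneq u v; first by apply/RP; exists u; rewrite // uv.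
  apply: contrapT => nR.
  have [a [ea ua una]] := adj_share eH ue.
  have [b [eb vb vnb]] := adj_share e''H ve''.
  have [v' [ev' uv' _]] := adj_share e'H ue'.
  have ? : v' = v by move: ve'; rewrite ev' !inE eq_sym (negPf uv) => /eqP.
  subst v'.
  have nR' x : x \in e -> x \in e'' -> False.
    by move=> xe xe''; apply: nR; apply/RP; exists x.
  apply: noP; exists a, u, v, b; split=> //; last by rewrite adj_sym.
  rewrite /= !inE !negb_or vnb uv eq_sym una /=.
  rewrite !andbT; apply/andP; split; first (apply/andP; split).
  - apply/eqP => e1; apply: (nR' v) => //; by rewrite ea -e1 !inE eqxx orbT.
  - apply/eqP => e1; apply: (nR' a); first by rewrite ea !inE eqxx orbT.
    by rewrite eb e1 !inE eqxx orbT.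
  - apply/eqP => e1; apply: (nR' u) => //; by rewrite eb e1 !inE eqxx orbT.
have Rsym (e e' : {set V}) : R e e' = R e' e by rewrite /R disjoint_sym.
have eqR : {in edges H & &, equivalence_rel R}.
  move=> e e' e'' eH e'H e''H; split; first exact: Rxx.
  move=> ee'; apply/idP/idP; last exact: Rtr.
  by apply: Rtr; rewrite // Rsym.
pose P := equivalence_partition R (edges H).
have partP : partition P (edges H) := equivalence_partitionP eqR.
have pb := pblock_equivalence_partition eqR.
have [/eqP covP trivP _] := and3P partP.
have inP B e : B \in P -> e \in B -> e \in edges H.
  by move=> BP eB; rewrite -covP; apply/bigcupP; exists B.
exists P; split=> // [B BP|B C BP CP nBC].
  have [e eB] : exists e, e \in B.
    by apply/set0Pn; apply: contraTneq BP => ->; case/and3P: partP.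
  have eH := inP _ _ BP eB.
  have inB e' : e' \in B -> R e e'.
    move=> e'B; rewrite -(pb e e') ?(inP B) //.
    by rewrite (def_pblock trivP BP eB).
  have [B1|] := boolP (B \subset [set e]).
    by left; apply/eqP/cards1P; exists e; apply/eqP; rewrite eqEsubset B1 sub1set.
  case/subsetPn => e' e'B; rewrite inE => ne; right.
  have e'H := inP _ _ BP e'B.
  have /RP [x xe xe'] := inB _ e'B.
  have [y [ey xy nxy]] := adj_share eH xe.
  have [z [ez xz nxz]] := adj_share e'H xe'.
  have nyz : y != z by apply: contraNneq ne => eyz; rewrite ey ez eyz.
  exists x, y, z; split.
    by rewrite /= !inE negb_or nxy nxz nyz.
  apply/eqP; rewrite eqEsubset; apply/andP; split; last first.
    by rewrite -ey -ez subUset !sub1set eB.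
  apply/subsetP => f fB; rewrite !inE -ey -ez.
  apply/negPn; rewrite negb_or; apply/negP => /andP [nfe nfe'].
  have fH := inP _ _ BP fB.
  have [xf|xf] := boolP (x \in f).
    have [w [ew xw nxw]] := adj_share fH xf.
    apply: noK; exists x, y, z, w; split=> //.
    rewrite /= !inE negb_or nyz andbT /=; apply/andP; split.
      by apply: contraNneq nfe => eyw; rewrite ew ey eyw.
    by apply: contraNneq nfe' => eyw; rewrite ew ez eyw.
  have yf : y \in f.
    have /RP [u] := inB _ fB; rewrite ey !inE => /orP [] /eqP -> // h.
    by rewrite h in xf.
  have zf : z \in f.
    have : R e' f by apply: (Rtr _ e) => //; [rewrite Rsym|]; apply: inB.
    case/RP => u; rewrite ez !inE => /orP [] /eqP -> // h.
    by rewrite h in xf.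
  have yz : adj H y z.
    have [w [ew yw nyw]] := adj_share fH yf.
    by move: zf; rewrite ew !inE eq_sym (negPf nyz) /= => /eqP ->.
  have := forestH [:: x; y; z].
  rewrite /ucycle /cycle /= xy yz adj_sym xz /= !inE negb_or nxy nxz nyz /=.
  by move/(_ isT).
apply/bigcup_disjointP => f fC; rewrite disjoint_sym.
apply/bigcup_disjointP => e eB.
apply/negPn/negP; rewrite -/(R f e) Rsym => efR; case/negP: nBC.
rewrite -(def_pblock trivP BP eB) -(def_pblock trivP CP fC).
rewrite eq_pblock ?covP ?(inP B) //.
by rewrite pb ?(inP B e) ?(inP C f).
Qed.

Section ForestColorings.
Variables (V1 V2 W : finType) (H1 : sgraph V1) (H2 : sgraph V2) (G : sgraph W).
Hypothesis forestG : is_forest G.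

(** A monochromatic copy of a matching contains two disjoint edges of one
    colour. *)
Lemma no_mono_matching (c : {set W} -> nat) :
  (1 < num_edges H1)%N -> is_matching H1 ->
  (forall e e', e \in edges G -> e' \in edges G -> c e = c e' -> ~~ [disjoint e & e']) ->
  ~ monochromatic_copy G c H1.
Proof.
move=> /card_gt1P [e [e' [eH e'H ne]]] mH ce [f [[injf fH] mono]].
have := ce _ _ (fH _ eH) (fH _ e'H) (mono _ _ eH e'H).
by rewrite imset_disjoint // (trivIsetP mH).
Qed.

Lemma arrow_point (v2 : V2) : (1 < num_edges H1)%N -> mr_arrow G H1 H2 -> W.
Proof.
move=> e1 arr; apply: (xchoose (P := xpredT)).
case: (arr (fun=> 0%N)) => -[f _]; last by exists (f v2).
have /card_gt0P [e /edge_adj [u _]] := ltnW e1.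
by exists (f u).
Qed.

(** Colour every edge by its vertex that comes first: a vertex then sees at most
    two colours, its own and that of its parent. *)
Lemma forest_no_claw_arrow : (1 < num_edges H1)%N -> is_matching H1 ->
  has_claw H2 -> ~ mr_arrow G H1 H2.
Proof.
move=> e1 mH1 [x [a [b [d [un xa xb xd]]]]] arr.
have nH1 := no_mono_matching e1 mH1.
have w0 := arrow_point x e1 arr.
have [s [j [us sN ltj js]]] := forest_order forestG w0 setT.
(* The colour of an edge is the position of its first endpoint in s. *)
pose c (e : {set W}) := find (mem e) s.
have hasc e : e \in edges G -> has (mem e) s.
  move=> eG; have /card_gt0P [u ue] : (0 < #|e|)%N by rewrite (edge_card eG).
  by apply/hasP; exists u; rewrite ?sN ?inE.
case: (arr c) => [|[f [[injf fH] rb]]].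
  apply: nH1 => e e' eG e'G ce; rewrite -setI_eq0; apply/set0Pn.
  exists (nth w0 s (c e)); rewrite inE; apply/andP; split.
    exact: (nth_find w0 (hasc _ eG)).
  by rewrite ce; exact: (nth_find w0 (hasc _ e'G)).
(* The edges at f x have at most two colours, but the claw needs three. *)
have two u : adj H2 x u -> c [set f x; f u] = index (f x) s \/
    c [set f x; f u] = j (index (f x) s).
  move=> /fH; rewrite imsetU1 imset_set1 => xuG.
  have ins w : w \in s by rewrite sN inE.
  have [m mE] : exists m, nth w0 s (c [set f x; f u]) = m by eexists.
  have : m \in [set f x; f u] by rewrite -mE; exact: (nth_find w0 (hasc _ xuG)).
  have cE : c [set f x; f u] = index m s.
    by rewrite -mE index_uniq // -has_find hasc.
  rewrite !inE => /orP [] /eqP em; first by left; rewrite cE em.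
  right; rewrite cE em; apply: js; rewrite ?nth_index ?ins //; last first.
    by rewrite /adj setUC.
  rewrite index_mem ins andbT ltn_neqAle; apply/andP; split.
    apply: contraTneq (adj_neq xuG) => e2; apply/negPn/eqP.
    by rewrite -(nth_index w0 (ins (f u))) e2 nth_index.
  rewrite -em -cE leqNgt; apply/negP => /(before_find w0).
  by rewrite nth_index //= !inE eqxx.
have ne u v : adj H2 x u -> adj H2 x v -> u != v ->
    c [set f x; f u] <> c [set f x; f v].
  move=> xu xv uv; have := rb _ _ xu xv; rewrite !imsetU1 !imset_set1; apply.
  apply: contra uv => /eqP/set2_inj -> //; exact: adj_neq xu.
move: un; rewrite /= !inE negb_or => /andP [/andP [ab ad]] /andP [bd _].
have := ne _ _ xa xb ab; have := ne _ _ xa xd ad; have := ne _ _ xb xd bd.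
by case: (two _ xa) => ->; case: (two _ xb) => ->; case: (two _ xd) => ->.
Qed.

(** Colour every edge by its endpoint in one class of the bipartition: the
    middle edge of a path on four vertices has its colour repeated. *)
Lemma forest_no_path4_arrow : (1 < num_edges H1)%N -> is_matching H1 ->
  has_path4 H2 -> ~ mr_arrow G H1 H2.
Proof.
move=> e1 mH1 [x [y [z [t [un xy yz zt]]]]] arr.
have nH1 := no_mono_matching e1 mH1.
have w0 := arrow_point x e1 arr.
have [s [j [us sN ltj js]]] := forest_order forestG w0 setT.
have [col colE] := parity_coloring ltj.
pose sg w := col (index w s).
have sgE u v : adj G u v -> sg u = ~~ sg v.
  have ins w : w \in s by rewrite sN inE.
  wlog lt : u v / (index u s < index v s)%N.
    move=> wlg uv; case: (ltngtP (index u s) (index v s)) => lt.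
    - exact: wlg.
    - by rewrite (wlg v u) ?negbK // adj_sym.
    - have := adj_neq uv; rewrite -(nth_index w0 (ins u)) lt nth_index //.
      by rewrite eqxx.
  move=> uv; rewrite /sg (colE (index v s)); last by apply: leq_ltn_trans lt.
  rewrite negbK; congr col; apply: js; rewrite ?nth_index ?ins //.
  by rewrite lt index_mem ins.
pose c (e : {set W}) : nat :=
  if [pick v in e | sg v] is Some v then enum_rank v else 0%N.
have cE u v : adj G u v -> sg u -> c [set u; v] = enum_rank u.
  move=> uv su; rewrite /c; case: pickP => [w|/(_ u)]; last by rewrite !inE eqxx su.
  rewrite !inE => /andP [/orP [] /eqP -> //].
  by rewrite -[sg v]negbK -(sgE _ _ uv) su.
have cE' u v : adj G u v -> exists w,
    [/\ w \in [set u; v], c [set u; v] = enum_rank w & sg w].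
  move=> uv; have [su|su] := boolP (sg u).
    by exists u; rewrite !inE eqxx cE.
  exists v; rewrite !inE eqxx orbT setUC cE //.
  - by rewrite -[sg v]negbK -(sgE _ _ uv).
  - by rewrite adj_sym.
  - by rewrite -[sg v]negbK -(sgE _ _ uv).
case: (arr c) => [|[f [[injf fH] rb]]].
  apply: nH1 => e e' /edge_adj [u [v [-> uv]]] /edge_adj [u' [v' [-> uv']]].
  have [w [wE -> _]] := cE' _ _ uv; have [w' [wE' -> _]] := cE' _ _ uv'.
  move=> /ord_inj/enum_rank_inj ww; rewrite -setI_eq0; apply/set0Pn.
  by exists w; rewrite inE wE ww wE'.
have fadj u v : adj H2 u v -> adj G (f u) (f v).
  by move=> /fH; rewrite imsetU1 imset_set1.
move: un; rewrite /= !inE !negb_or => /andP [/and3P [xny xnz xnt]] /andP [].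
move=> /andP [ynz ynt] _.
have ne u v v' : adj H2 u v -> adj H2 u v' -> v != v' ->
    c [set f u; f v] <> c [set f u; f v'].
  move=> uv uv' vv'; have := rb _ _ uv uv'; rewrite !imsetU1 !imset_set1; apply.
  apply: contra vv' => /eqP/set2_inj -> //; exact: adj_neq uv.
rewrite adj_sym in xy.
have [sy|sy] := boolP (sg (f y)).
  by have := ne _ _ _ xy yz xnz; rewrite !cE ?fadj.
have sz : sg (f z) by rewrite -[sg _]negbK -(sgE _ _ (fadj _ _ yz)).
rewrite adj_sym in yz; have := ne _ _ _ yz zt ynt.
by rewrite !cE ?fadj.
Qed.

End ForestColorings.

(** Writing the path along [s] as a tree in which the parent of a vertex is its
    predecessor gives the distinctness of its edges for free; only the closing
    edge needs [2 < size s]. *)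
Definition cycle_edges (W : finType) (w0 : W) (s : seq W) : {set {set W}} :=
  [set nth w0 s 0; nth w0 s (size s).-1] |: tree_edges (nth w0 s) predn (size s).

Lemma card_cycle_edges (W : finType) (w0 : W) (s : seq W) :
  uniq s -> (2 < size s)%N -> #|cycle_edges w0 s| = size s.
Proof.
move=> un lt; have injx : {in gtn (size s) &, injective (nth w0 s)}.
  by move=> a b; rewrite !inE => la lb /eqP; rewrite nth_uniq // => /eqP.
rewrite cardsU1 card_tree_edges //; last by move=> i; rewrite ltn_predL.
suff -> : [set nth w0 s 0; nth w0 s (size s).-1] \notin
    tree_edges (nth w0 s) predn (size s) by rewrite add1n prednK //; lia.
apply/imsetP => -[i _ /setP e].
have li : (i.+1 < size s)%N by rewrite -ltn_predRL.
have la : ((size s).-1 < size s)%N by lia.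
have l0 : (0 < size s)%N by lia.
have e0 := e (nth w0 s 0); have e1 := e (nth w0 s (size s).-1).
move: e0 e1; rewrite !inE !eqxx ?orbT !nth_uniq //=; [|lia|lia].
by move=> /esym/eqP <- /esym/orP [] /eqP; lia.
Qed.

Lemma cycle_edges_sub (W : finType) (w0 : W) (s : seq W) (G : sgraph W) :
  cycle (adj G) s -> (1 < size s)%N -> cycle_edges w0 s \subset edges G.
Proof.
case: s => // x s; rewrite /= rcons_path => /andP [px lx] ls.
rewrite subUset sub1set /=; apply/andP; split.
  by rewrite setUC -[size s]/((size (x :: s)).-1) nth_last.
apply/subsetP => e /imsetP [i _ ->] /=; rewrite setUC.
by move/(pathP w0): px => /(_ i (ltn_ord i)).
Qed.

Lemma cycle_edges_in (W : finType) (w0 : W) (s : seq W) e :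
  (0 < size s)%N -> e \in cycle_edges w0 s -> e \subset [set x in s].
Proof.
move=> s0; have ins i : (i < size s)%N -> nth w0 s i \in s by apply: mem_nth.
rewrite !inE => /orP [/eqP ->|/imsetP [i _ ->]]; rewrite subUset !sub1set !inE !ins //.
- by rewrite ltn_predL.
- by rewrite (leq_trans (ltn_ord i)) // leq_pred.
- by rewrite -ltn_predRL.
Qed.

(** * Rainbow forests *)

(** A digraph in which all in-degrees are less than [d] has average total degree
    less than [2d], so independent sets can be chosen greedily. *)
Lemma independent_set (W : finType) (r : rel W) (d : nat) (Z : {set W}) :
  irreflexive r -> {in Z, forall v, (#|[set u in Z | r v u]| < d)%N} ->
  exists I : {set W}, [/\ I \subset Z, (#|Z| <= 2 * d * #|I|)%N &
    {in I &, forall u v, ~~ r u v}].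
Proof.
move=> irr; have [n] := ubnP #|Z|; elim: n Z => // n IHn Z ltn degZ.
have [->|Z0] := eqVneq Z set0.
  exists set0; split; rewrite ?sub0set ?cards0 // => u v; by rewrite inE.
pose inn v := [set u in Z | r v u]; pose out v := [set u in Z | r u v].
(* In-degrees and out-degrees have the same sum, so some total degree is small. *)
have [v vZ degv] : exists2 v, v \in Z & (#|inn v| + #|out v| < 2 * d)%N.
  have [w wZ] := set0Pn _ Z0; have d0 := leq_trans (ltn0Sn _) (degZ _ wZ).
  apply/exists_inP; rewrite -[X in is_true X]negbK negb_exists_in.
  apply/negP => /forall_inP h.
  have : (\sum_(v in Z) 2 * d <= \sum_(v in Z) (#|inn v| + #|out v|))%N.
    by apply: leq_sum => v /h; rewrite -leqNgt.
  have eio : (\sum_(v in Z) #|out v| = \sum_(v in Z) #|inn v|)%N.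
    rewrite /inn /out; under eq_bigr do rewrite -sum1dep_card big_mkcondr /=.
    by rewrite exchange_big /=; apply: eq_bigr => u _; rewrite -sum1dep_card [RHS]big_mkcondr.
  have -> : (\sum_(v in Z) (#|inn v| + #|out v|) = 2 * \sum_(v in Z) #|inn v|)%N.
    by rewrite big_split mul2n -addnn; congr (_ + _)%N.
  rewrite sum_nat_const mulnCA leq_mul2l /= => le.
  have : (\sum_(v in Z) #|inn v| <= \sum_(v in Z) d.-1)%N.
    by apply: leq_sum => u /degZ; rewrite -/(inn u); case: (d) d0.
  rewrite sum_nat_const => le'; have := leq_trans le le'.
  rewrite leq_mul2l cards_eq0 (negPf Z0) /=; lia.
pose Z' := Z :\: (v |: (inn v :|: out v)).
have sZ' : Z' \subset Z by apply: subsetDl.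
have [|u uZ'|I [sI leI indI]] := IHn Z'.
- rewrite -ltnS; apply: leq_trans ltn; rewrite ltnS; apply: proper_card.
  rewrite properE sZ'; apply/subsetPn; exists v => //.
  by rewrite !inE eqxx.
- apply: leq_ltn_trans (degZ u (subsetP sZ' _ uZ')); apply: subset_leq_card.
  by apply/subsetP => w; rewrite !inE => /andP [/andP [_ ->] ->].
have vI : v \notin I by apply/negP => /(subsetP sI); rewrite !inE eqxx.
exists (v |: I); split.
- by rewrite subUset sub1set vZ (subset_trans sI).
- rewrite cardsU1 vI mulnDr muln1 /=.
  apply: (@leq_trans (#|v |: (inn v :|: out v)| + #|Z'|)%N).
    by rewrite -(cardsID (v |: (inn v :|: out v)) Z) leq_add2r subset_leq_card ?subsetIr.
  apply: leq_add leI; apply: leq_trans (leq_card_setU _ _) _.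
  by rewrite cards1 add1n (leq_ltn_trans (leq_card_setU _ _)).
move=> u w; rewrite !inE.
have key w' : w' \in I -> ~~ r v w' /\ ~~ r w' v.
  move=> /(subsetP sI); rewrite !inE !negb_or => /andP [/andP [_ +] w'Z].
  by rewrite w'Z => /andP.
case/orP => [/eqP ->|uI]; case/orP => [/eqP ->|wI].
- by rewrite irr.
- by case: (key w wI).
- by case: (key u uI).
- exact: indI.
Qed.

Section RainbowTree.
Variables (V1 V2 W : finType) (H1 : sgraph V1) (H2 : sgraph V2) (G : sgraph W).
Variables (c : {set W} -> nat) (M : nat).
Hypotheses (matching1 : is_matching H1) (forest2 : is_forest H2).
Hypothesis no_mono : ~ monochromatic_copy G c H1.
Hypothesis span : forall Z : {set W}, (M <= #|Z|)%N ->
  exists2 e, e \in edges G & e \subset Z.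
Hypothesis leV1 : (#|V1| <= #|W|)%N.

Let t := (2 * num_edges H1)%N.
Let k := #|V2|.
Let d := (k + k * t).+1.

(** A colour class contains no copy of the matching [H1], so it has a vertex
    cover of bounded size. *)
Lemma class_covers (w : W) : exists C : nat -> {set W},
  (forall a, (#|C a| <= t)%N) /\
  forall u v, adj G u v ->
    (u \in C (c [set u; v])) || (v \in C (c [set u; v])).
Proof.
have /choice [C hC] : forall a, exists C : {set W}, (#|C| <= t)%N /\
    forall e, e \in edges G -> c e = a -> ~~ [disjoint e & C].
  move=> a; have [|e||[C [leC hC]]] := @matching_or_cover _ _ (edges H1)
    [set e in edges G | c e == a] w matching1.
  - exact: edge_card.
  - by rewrite inE => /andP [/edge_card].
  - case=> f [injf fY]; case: no_mono.
    have fG e : e \in edges H1 -> f @: e \in edges G.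
      by move=> /fY; rewrite inE => /andP [].
    have [|g [gH gf]] := extend_copy _ fG leV1; first by rewrite nonisolatedE.
    exists g; split=> // e e' eH e'H; rewrite !gf //.
    by have := fY _ eH; have := fY _ e'H; rewrite !inE => /andP [_ /eqP ->] /andP [_ /eqP ->].
  exists C; split=> // e eG ce; apply: hC; rewrite inE eG; exact/eqP.
exists C; split=> [a|u v uv]; first by case: (hC a).
have [_ /(_ _ uv erefl)] := hC (c [set u; v]).
by rewrite -setI_eq0 => /set0Pn [x]; rewrite !inE => /andP [/orP [] /eqP -> ->]; rewrite ?orbT.
Qed.

(** Few vertices fail to be good at one of the first [k] levels, where being good
    at level [m.+1] means having [d] in-neighbours that are good at level [m]. From
    a vertex good at level [k] the forest is embedded along in-edges, one vertex
    after the other, the goodness dropping by one at each step. *)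
Lemma rainbow_forest : (2 * d * M * k < #|W|)%N -> rainbow_copy G c H2.
Proof.
move=> ltW; have [w _] : exists w : W, w \in setT.
  by apply/card_gt0P; rewrite cardsT (leq_trans _ ltW).
have [C [leC coverC]] := class_covers w.
(* Orient every edge away from a vertex of the cover of its colour class; then
   each colour occurs at most t times among the edges entering a vertex. *)
pose inn v u := adj G v u && (u \in C (c [set v; u])).
have inn_irr : irreflexive inn.
  by move=> u; apply/negP => /andP [/adj_neq]; rewrite eqxx.
pose good := fix good n := if n is m.+1 then
  [set v in good m | (d <= #|[set u in good m | inn v u]|)%N] else [set: W].
have goodS n : good n.+1 \subset good n.
  by apply/subsetP => v; rewrite inE => /andP [].
have good_mono a b : (a <= b)%N -> good b \subset good a.
  elim: b => [|b IHb]; first by rewrite leqn0 => /eqP ->.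
  rewrite leq_eqVlt => /orP [/eqP ->|] //; rewrite ltnS => /IHb.
  exact: subset_trans (goodS b).
(* The vertices lost at one level have fewer than d in-neighbours among
   themselves, so a proportion of them is independent, hence of size below M. *)
have loss n : (#|good n :\: good n.+1| <= 2 * d * M)%N.
  have [|I [sI leI indI]] := @independent_set W inn d (good n :\: good n.+1) inn_irr.
    move=> v; rewrite inE => /andP [vg' vg]; rewrite inE vg -ltnNge in vg'.
    apply: leq_ltn_trans vg'; apply: subset_leq_card; apply/subsetP => u.
    by rewrite !inE => /andP [/andP [_ ->] ->].
  apply: leq_trans leI _; rewrite leq_mul2l leqNgt orbC.
  apply/orP; left; apply/negP => ltI; have [e eG] := span (ltnW ltI).
  have [a [b [-> ab]]] := edge_adj eG; rewrite subUset !sub1set => /andP [aI bI].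
  have := indI a b aI bI; have := indI b a bI aI; rewrite /inn adj_sym ab /=.
  by have := coverC a b ab; rewrite (setUC [set b]) => /orP [] ->.
have goodk : (0 < #|good k|)%N.
  have : forall n, (#|W| <= #|good n| + 2 * d * M * n)%N.
    elim=> [|n IHn]; first by rewrite cardsT leq_addr.
    apply: leq_trans IHn _; rewrite mulnS addnA leq_add2r.
    rewrite -(cardsID (good n.+1) (good n)) leq_add ?loss //.
    by rewrite subset_leq_card ?subsetIr.
  by move/(_ k)/(leq_trans ltW); rewrite -[X in (X < _)%N]add0n ltn_add2r.
have [v0 _|V20] := pickP (mem [set: V2]); last first.
  exists (fun v => w); split=> [|e e' eH].
    split=> [v|e eH]; first by have := V20 v; rewrite !inE.
    by have [v] := edge_adj eH; have := V20 v; rewrite !inE.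
  by have [v] := edge_adj eH; have := V20 v; rewrite !inE.
have [s [j [us sN ltj js]]] := forest_order forest2 v0 setT.
have ins v : v \in s by rewrite sN inE.
have sk : size s = k.
  by rewrite -(card_uniqP us) (eq_card (B := [set: V2])) ?cardsT // => v; rewrite sN.
have {goodk} [x [injx inx rbx _]] : exists x : nat -> W,
  [/\ {in gtn k &, injective x},
      forall i, (0 < i < k)%N -> inn (x (j i)) (x i),
      forall a b, (0 < a < k)%N -> (0 < b < k)%N ->
        c [set x (j a); x a] = c [set x (j b); x b] -> a = b &
      forall i, (i < k)%N -> x i \in good (k - i)%N].
  (* Each new vertex avoids fewer than d in-neighbours of its parent: the
     vertices already used, and those joined by a colour already used. *)
  suff: forall n, (n <= k)%N -> exists x : nat -> W,
    [/\ {in gtn n &, injective x},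
      forall i, (0 < i < n)%N -> inn (x (j i)) (x i),
      forall a b, (0 < a < n)%N -> (0 < b < n)%N ->
        c [set x (j a); x a] = c [set x (j b); x b] -> a = b &
      forall i, (i < n)%N -> x i \in good (k - i)%N] by apply.
  elim=> [_|n IHn ltn].
    by exists (fun=> w); split=> // [i|a b]; rewrite ltn0 andbF.
  have [x [injx inx rbx gx]] := IHn (ltnW ltn).
  suff [u [gu ux un]] : exists u, [/\ u \in good (k - n)%N,
      forall i, (i < n)%N -> x i != u &
      (0 < n)%N -> inn (x (j n)) u /\ forall a, (0 < a < n)%N ->
         c [set x (j a); x a] <> c [set x (j n); u]].
    pose y i := if i == n then u else x i.
    have yx i : (i < n)%N -> y i = x i by move=> lt; rewrite /y ltn_eqF.
    have yn : y n = u by rewrite /y eqxx.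
    exists y; split.
    - move=> a b; rewrite !inE !ltnS leq_eqVlt => /orP [/eqP ->|la].
        rewrite leq_eqVlt => /orP [/eqP -> //|lb]; rewrite yn yx // => e.
        by have := ux b lb; rewrite e eqxx.
      rewrite leq_eqVlt => /orP [/eqP ->|lb].
        by rewrite yn yx // => e; have := ux a la; rewrite e eqxx.
      by rewrite !yx //; apply: injx.
    - move=> i /andP [i0]; rewrite ltnS leq_eqVlt => /orP [/eqP ei|li].
        by rewrite ei yn yx ?ltj -?ei //; case: un => //; rewrite -ei.
      by rewrite !yx ?(ltn_trans (ltj _ _) li) // inx // i0.
    - move=> a b /andP [a0]; rewrite ltnS leq_eqVlt => /orP [/eqP ea|la] /andP [b0];
        rewrite ltnS leq_eqVlt => /orP [/eqP eb|lb].
      + by rewrite ea eb.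
      + have jb := ltn_trans (ltj b b0) lb; rewrite {a}ea in a0 *.
        rewrite yn (yx _ lb) (yx _ jb) (yx _ (ltj n a0)) => e.
        by case: (un a0) => _ /(_ b); rewrite b0 lb => /(_ isT); rewrite e.
      + have ja := ltn_trans (ltj a a0) la; rewrite {b}eb in b0 *.
        rewrite yn (yx _ la) (yx _ ja) (yx _ (ltj n b0)) => e.
        by case: (un b0) => _ /(_ a); rewrite a0 la => /(_ isT); rewrite e.
      + rewrite !yx ?(ltn_trans (ltj _ _) la) ?(ltn_trans (ltj _ _) lb) //.
        by apply: rbx; rewrite ?a0 ?b0.
    - move=> i; rewrite ltnS leq_eqVlt => /orP [/eqP ->|li]; first by rewrite yn.
      by rewrite yx // gx.
  have [n0|n0] := posnP n.
    by case/card_gt0P: goodk => u gu; exists u; rewrite n0 subn0; split.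
  have lj := ltj n n0.
  have : x (j n) \in good (k - n).+1.
    apply: (subsetP (good_mono _ (k - j n)%N _)); last exact: gx.
    by lia.
  rewrite inE => /andP [_].
  set A := [set u in _ | _] => leA.
  pose used := [set x (val i) | i : 'I_n].
  have leused : (#|used| <= n)%N.
    by rewrite (leq_trans (leq_imset_card _ _)) // card_ord.
  pose bads := \bigcup_(a < n) C (c [set x (j a); x a]).
  have lebads : (#|bads| <= n * t)%N.
    apply: (@leq_trans (\sum_(a < n) t)%N); last by rewrite sum_nat_const card_ord.
    rewrite /bads; elim/big_rec2: _ => [|i m B _ leB]; first by rewrite cards0.
    by apply: leq_trans (leq_card_setU _ _) _; rewrite leq_add.
  have /subsetPn [u uA] : ~~ (A \subset used :|: bads).
    apply/negP => /subset_leq_card h; have := leq_trans leA h.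
    have := leq_card_setU used bads; rewrite /d => h1 h2.
    have := leq_trans h2 h1; rewrite ltnNge => /negP; apply.
    apply: leq_add; first by apply: leq_trans leused (ltnW ltn).
    by apply: leq_trans lebads _; rewrite leq_mul2r (ltnW ltn) orbT.
  rewrite inE negb_or => /andP [uused ubads].
  move: uA; rewrite inE => /andP [gu innu].
  exists u; split=> // [i li|_].
    by apply: contraNneq uused => <-; apply/imsetP; exists (Ordinal li).
  split=> // a /andP [a0 la] e; case/negP: ubads.
  apply/bigcupP; exists (Ordinal la) => //=; rewrite e.
  by case/andP: innu.
have ik v : (index v s < k)%N by rewrite -sk index_mem.
have lt_edge e : e \in edges H2 -> exists i, (0 < i < k)%N /\
    e = [set nth v0 s (j i); nth v0 s i].
  move=> /edge_adj [u [v [-> uv]]].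
  wlog lt : u v uv / (index u s < index v s)%N.
    move=> wlg; case: (ltngtP (index u s) (index v s)) => lt.
    - exact: wlg.
    - by rewrite setUC; apply: wlg => //; rewrite adj_sym.
    - have := adj_neq uv; rewrite -(nth_index v0 (ins u)) lt nth_index //.
      by rewrite eqxx.
  have ji : index u s = j (index v s).
    by apply: js; rewrite ?nth_index // lt index_mem ins.
  exists (index v s); rewrite ik (leq_ltn_trans _ lt) // -ji !nth_index //.
pose f v := x (index v s).
have fnth i : (i < k)%N -> f (nth v0 s i) = x i.
  by move=> lt; rewrite /f index_uniq // sk.
have fe i : (0 < i < k)%N -> f @: [set nth v0 s (j i); nth v0 s i] =
    [set x (j i); x i].
  move=> /andP [i0 ltik]; rewrite imsetU1 imset_set1 !fnth //.
  exact: ltn_trans (ltj i i0) ltik.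
exists f; split; first split.
- move=> u v /injx; rewrite !inE => /(_ (ik u) (ik v)) e.
  by rewrite -(nth_index v0 (ins u)) e nth_index.
- move=> e /lt_edge [i [hi ->]]; rewrite fe //.
  by case/andP: (inx i hi).
move=> e e' /lt_edge [a [ha ->]] /lt_edge [b [hb ->]]; rewrite !fe // => ne.
by move/(rbx _ _ ha hb) => ab; rewrite ab eqxx in ne.
Qed.

End RainbowTree.

(** * Threshold functions *)

Section Threshold.
Variables (R : realType) (P : forall n, sgraph 'I_n -> Prop).

(** With the exponent written positively, [p / phat] becomes [p * n `^ a], and both
    limits become statements uniform in [p], free of sequences. *)
Lemma threshold_intro (a : R) : 0 < a ->
  (forall e : R, 0 < e -> exists (B : R) (n0 : nat), forall n (p : R),
     (n0 <= n)%N -> 0 <= p <= 1 -> B <= p * n%:R `^ a ->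
     Pr p (pairs [set: 'I_n]) (fun X => exists2 G, edges G = X & ~ @P n G) <= e) ->
  (forall e : R, 0 < e -> exists (b : R) (n0 : nat), 0 < b /\ forall n (p : R),
     (n0 <= n)%N -> 0 <= p <= 1 -> p * n%:R `^ a <= b ->
     Pr p (pairs [set: 'I_n]) (fun X => exists2 G, edges G = X & @P n G) <= e) ->
  is_threshold (fun n : nat => (n%:R : R) `^ (- a)) P.
Proof.
move=> a0 up low; split.
- move=> n; rewrite powR_ge0 /= powRN; case: n => [|n].
    by rewrite powR0 ?gt_eqF // invr0 ler01.
  by rewrite invf_le1 ?powR_gt0 // -[leLHS](powRr0 n.+1%:R) ler_powR ?ler1n // ltW.
- move=> p p01; under eq_fun do rewrite powRN invrK.
  move=> /cvgryPge h; apply/cvgrPdist_le => e e0.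
  have [B [n0 hB]] := up e e0.
  near=> n; have pn := p01 n.
  rewrite prob_GnpE ger0_norm ?subr_ge0 ?Pr_le1 //.
  rewrite lerBlDr addrC -lerBlDl.
  have <- := PrC (p n) (pairs [set: 'I_n]) (fun X => exists2 G, edges G = X & @P n G).
  rewrite addrC addKr.
  have : Pr (p n) (pairs [set: 'I_n]) (fun X => exists2 G, edges G = X & ~ @P n G) <= e.
    apply: hB => //; first by near: n; exists n0.
    by near: n; apply: h.
  apply: le_trans; apply: Pr_le => // X /pairs_graph [G GX] nP.
  by exists G => // PG; apply: nP; exists G.
- move=> p p01; under eq_fun do rewrite powRN invrK.
  move=> /cvgrPdist_le h; apply/cvgrPdist_le => e e0.
  have [b [n0 [b0 hb]]] := low e e0.
  near=> n; have pn := p01 n.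
  rewrite prob_GnpE sub0r normrN ger0_norm ?Pr_ge0 //.
  apply: hb => //; first by near: n; exists n0.
  rewrite -[leLHS]ger0_norm ?mulr_ge0 ?powR_ge0 //; last by case/andP: pn.
  by rewrite -normrN -sub0r; near: n; apply: h.
Unshelve. all: by end_near.
Qed.

End Threshold.

(** * The containment threshold *)

Lemma part_size n v : (0 < v)%N -> (2 * v <= n)%N ->
  (n <= 4 * v * (n./2 %/ v))%N.
Proof.
move=> v0 n0; have N0 : (0 < n./2 %/ v)%N by rewrite divn_gt0 //; lia.
have := ltn_ceil n./2 v0; rewrite mulSn => h.
have : (v <= n./2 %/ v * v)%N by rewrite leq_pmull.
rewrite -mulnA [(v * _)%N]mulnC; move: (_ %/ v * v)%N h => q; lia.
Qed.

Lemma half_geqn n v : (2 * v <= n)%N -> (v <= n./2)%N.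
Proof. lia. Qed.

Lemma half_leqn n : (n./2 <= n)%N.
Proof. lia. Qed.

Definition lower n : {set 'I_n} := [set i : 'I_n | (i < n./2)%N].

Section Containment.
Variables (R : realType) (V : finType) (H : sgraph V).
Hypothesis edges_gt0 : (0 < num_edges H)%N.

(** The sum factors over the vertices: agreeing at a vertex has one choice and
    weight [N], disagreeing has [N - 1] choices and weight 1. *)
Lemma ffun_agreement (N : nat) (f : {ffun V -> 'I_N}) :
  \sum_(g : {ffun V -> 'I_N}) (N%:R : R) ^+ #|[set x | f x == g x]| <=
  (2 * N%:R) ^+ #|V|.
Proof.
have -> : \sum_(g : {ffun V -> 'I_N}) (N%:R : R) ^+ #|[set x | f x == g x]| =
    \prod_x \sum_(b : 'I_N) (if f x == b then N%:R else 1).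
  rewrite bigA_distr_bigA; apply: eq_bigr => g _.
  by rewrite -big_mkcond prodr_const; congr (_ ^+ _); apply: eq_card => x; rewrite inE.
rewrite -prodr_const; apply: ler_prod => x _; apply/andP; split.
  by apply: sumr_ge0 => b _; case: ifP => _; rewrite ?ler0n ?ler01.
rewrite (bigD1 (f x)) //= eqxx mulrDl mul1r lerD2l.
rewrite (eq_bigr (fun=> 1)) => [|b /negPf]; last by rewrite eq_sym => ->.
rewrite sumr_const ler_nat; apply: leq_trans (max_card _) _.
by rewrite card_ord.
Qed.

(** Second moment method, restricted to copies mapping every vertex of [H] into
    a part of its own: two such copies share exactly the edges of [H] between
    the vertices on which they agree. *)
Lemma containment_bound (W : finType) (A : {set W}) (N : nat)
    (pt : V -> 'I_N -> W) (p B : R) :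
  (forall x a, pt x a \in A) ->
  (forall x a y b, pt x a = pt y b -> x = y /\ a = b) ->
  0 <= p <= 1 -> 0 < B ->
  (forall S : {set V}, (0 < #|inside H S|)%N ->
     B <= N%:R ^+ #|S| * p ^+ #|inside H S|) ->
  Pr p (pairs A) (fun X => ~ exists f : V -> W, [/\ injective f,
     forall x, f x \in A & forall e, e \in edges H -> f @: e \in X]) <=
  2 ^+ #|V| / B.
Proof.
move=> ptA ptI p01 B0 hB; have [p0 p1] := andP p01.
pose F (f : {ffun V -> 'I_N}) x := pt x (f x).
have injF f : injective (F f) by move=> x y /ptI [].
pose D f := [set F f @: e | e : {set V} in edges H].
set d := num_edges H.
have sD f : D f \subset pairs A.
  apply/subsetP => _ /imsetP [e eH ->]; rewrite inE card_imset // (edge_card eH) eqxx.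
  by apply/subsetP => _ /imsetP [x _ ->]; apply: ptA.
have cD f : #|D f| = d by rewrite card_imset //; apply: imset_inj.
pose S (f g : {ffun V -> 'I_N}) := [set x | f x == g x].
have DI f g : (#|D f :&: D g| <= #|inside H (S f g)|)%N.
  suff : D f :&: D g \subset [set F f @: e | e : {set V} in inside H (S f g)].
    move=> /subset_leq_card h; apply: leq_trans h (leq_imset_card _ _).
  apply/subsetP => h; rewrite inE => /andP [/imsetP [e eH ->] /imsetP [e' _ ee']].
  apply/imsetP; exists e => //; rewrite inE eH; apply/subsetP => x xe.
  have : F f x \in F g @: e' by rewrite -ee' imset_f.
  by case/imsetP => y _ /ptI [<- fg]; rewrite inE fg.
pose mu := (N%:R : R) ^+ #|V| * p ^+ d.
have mu0 : 0 < mu.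
  have insT : inside H setT = edges H.
    by apply/setP => e; rewrite inE subsetT andbT.
  have := hB setT; rewrite insT cardsT => /(_ edges_gt0); exact: lt_le_trans.
have sm := Pr_second_moment p01 sD cD.
rewrite card_ffun card_ord natrX -/mu in sm.
set LHS := Pr _ _ _.
have leL : LHS <= Pr p (pairs A) (fun X => forall f, ~~ (D f \subset X)).
  apply: Pr_le => // X _ noX f; apply/negP => /subsetP sDX; apply: noX.
  exists (F f); split=> //; first by move=> x; apply: ptA.
  by move=> e eH; apply/sDX/imsetP; exists e.
apply: le_trans leL _; rewrite -(ler_pM2r (exprn_gt0 2 mu0)).
apply: le_trans sm _.
have -> : 2 ^+ #|V| / B * mu ^+ 2 = \sum_(f : {ffun V -> 'I_N})
    (p ^+ (d + d) / B * (2 * N%:R) ^+ #|V|).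
  rewrite sumr_const card_ffun card_ord -[RHS]mulr_natr natrX /mu exprD.
  rewrite [(2 * N%:R) ^+ _]exprMn.
  by move: (2 ^+ _) (N%:R ^+ _) (p ^+ _) (B^-1) => x1 x2 x3 x4; ring.
apply: ler_sum => f _; apply: le_trans (ler_wpM2l _ (ffun_agreement f)); last first.
  by rewrite divr_ge0 ?exprn_ge0 // ltW.
rewrite mulr_sumr; apply: ler_sum => g _; rewrite -/(S f g).
have cDU : #|D f :|: D g| = (d + d - #|D f :&: D g|)%N by rewrite cardsU !cD.
have [i0|i0] := posnP #|inside H (S f g)|.
  have := DI f g; rewrite i0 leqn0 cDU => /eqP ->; rewrite subn0 subrr.
  by rewrite mulr_ge0 ?divr_ge0 ?exprn_ge0 // ltW.
have leid : (#|inside H (S f g)| <= d + d)%N.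
  apply: leq_trans (leq_addr _ _); apply: subset_leq_card.
  by apply/subsetP => e; rewrite inE => /andP [].
apply: (@le_trans _ _ (p ^+ (d + d - #|inside H (S f g)|))).
  rewrite -[leRHS]subr0 lerB ?exprn_ge0 // cDU.
  by apply: ler_wiXn2l => //; apply: leq_sub2l.
rewrite mulrAC ler_pdivlMr // -{2}(subnK leid) exprD -mulrA ler_wpM2l ?exprn_ge0 //.
by rewrite mulrC hB.
Qed.

(** With parts of size proportional to [n], the expected number of copies of the
    subgraph spanned by [S] is at least of order [(p * n `^ (1 / m)) ^+ i], where
    [i] counts its edges; this is the bound that [containment_bound] asks for. All
    copies are kept in one half of the vertices, so that the edges outside this
    half remain available. *)
Lemma containment (m : R) : 0 < m ->
  (forall S : {set V}, #|inside H S|%:R <= m * #|S|%:R) ->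
  forall e : R, 0 < e -> exists (B : R) (n0 : nat), forall n (p : R),
     (n0 <= n)%N -> 0 <= p <= 1 -> B <= p * n%:R `^ (1 / m) ->
     Pr p (pairs (lower n)) (fun X => ~ exists f : V -> 'I_n, [/\ injective f,
       forall x, f x \in lower n & forall e, e \in edges H -> f @: e \in X]) <= e.
Proof.
move=> m0 dens e e0; set v := #|V|.
have v0 : (0 < v)%N.
  by case/card_gt0P: edges_gt0 => d /edge_adj [u _]; apply/card_gt0P; exists u.
pose c : R := (4 * v)%:R ^+ v.
have c0 : 0 < c by rewrite exprn_gt0 // ltr0n muln_gt0.
exists (Num.max 1 (2 ^+ v * c / e)), (2 * v)%N => n p n0 p01 hB.
have [p0 p1] := andP p01.
set B := Num.max 1 _ in hB.
have B1 : 1 <= B by rewrite le_max lexx.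
have B0 : 0 < B by apply: lt_le_trans ltr01 B1.
(* The lower half is cut into #|V| consecutive parts of N vertices. *)
pose N := (n./2 %/ v)%N.
have N0 : (0 < N)%N by rewrite divn_gt0 // half_geqn.
have leNn : (N * v <= n./2)%N by apply: leq_trunc_div.
have lenN : (n <= 4 * v * N)%N by apply: part_size.
have ltpt (x : V) (a : 'I_N) : (enum_rank x * N + a < n./2)%N.
  apply: leq_trans leNn; apply: (@leq_trans (enum_rank x * N + N)%N).
    by rewrite ltn_add2l.
  by rewrite addnC -mulSn mulnC leq_mul2l; apply/orP; right; apply: ltn_ord.
have half_n i : (i < n./2)%N -> (i < n)%N by move/leq_trans; apply; apply: half_leqn.
pose pt x a := Ordinal (half_n _ (ltpt x a)).
have ptA x a : pt x a \in lower n by rewrite inE; apply: ltpt.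
have := @containment_bound _ (lower n) N pt p (B / c) ptA _ p01 (divr_gt0 B0 c0).
rewrite -/v => /(_ _ _)/le_trans; apply.
- move=> x a y b /(congr1 val) /= h.
  have ab : a = b.
    have := congr1 (modn^~ N) h; rewrite /= !modnMDl !modn_small ?ltn_ord //.
    exact: val_inj.
  split=> //; move: h; rewrite ab => /addIn/eqP; rewrite eqn_pmul2r // => /eqP h.
  by apply/enum_rank_inj/val_inj.
- move=> S i0; set s := #|S|; set i := #|_| in i0 *.
  have n1 : 1 <= n%:R :> R by rewrite ler1n (leq_trans _ n0) // muln_gt0.
  rewrite ler_pdivrMr //.
  apply: (@le_trans _ _ ((p * n%:R `^ (1 / m)) ^+ i)).
    by apply: le_trans (hB) _; apply: ler_eXnr => //; exact: le_trans B1 hB.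
  rewrite exprMn [leRHS]mulrAC [leLHS]mulrC ler_wpM2r ?exprn_ge0 //.
  rewrite -[leLHS]powR_mulrn ?powR_ge0 // -powRrM.
  apply: (@le_trans _ _ (n%:R ^+ s)).
    rewrite -[leRHS]powR_mulrn ?ler0n // ler_powR // mulrC mul1r ler_pdivrMr // mulrC.
    exact: dens.
  apply: (@le_trans _ _ (((4 * v)%:R * N%:R) ^+ s)).
    by rewrite lerXn2r ?nnegrE ?ler0n ?mulr_ge0 ?ler0n // -natrM ler_nat.
  rewrite exprMn mulrC ler_wpM2l ?exprn_ge0 ?ler0n // /c.
  by apply: ler_weXn2l; [rewrite ler1n muln_gt0|exact: max_card].
rewrite invf_div mulrA ler_pdivrMr // [e * _]mulrC -ler_pdivrMr //.
by rewrite /B le_max lexx orbT.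
Qed.

End Containment.

(** * Meeting many large edge sets *)

Section Avoid.
Variable R : realType.
Implicit Types p : R.

(** Bernoulli's inequality for [(1 + p) ^ L], since [(1 - p) * (1 + p) <= 1]. *)
Lemma expr_onem_le p L : 0 <= p <= 1 -> (1 - p) ^+ L <= (1 + L%:R * p)^-1.
Proof.
move=> /andP [p0 p1].
have pos k : 0 < 1 + k%:R * p by rewrite ltr_wpDr ?mulr_ge0 ?ler0n.
rewrite -[leRHS]mul1r ler_pdivlMr //.
elim: L => [|L IHL]; first by rewrite expr0 mul0r addr0 mulr1.
apply: le_trans IHL; rewrite exprSr -mulrA ler_wpM2l ?exprn_ge0 ?subr_ge0 //.
have := ler0n R L; rewrite -natr1; nra.
Qed.

(** Union bound over vertex sets: if [p * n] is large, then all of the at most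
    [2 ^ n] sets of quadratic size [D S] are hit. *)
Lemma avoid_family (c : nat) (e : R) : (0 < c)%N -> 0 < e ->
  exists (B : R) (n0 : nat), forall n p, (n0 <= n)%N -> 0 <= p <= 1 -> B <= p * n%:R ->
  forall (E : {set {set 'I_n}}) (Q : pred {set 'I_n}) (D : {set 'I_n} -> {set {set 'I_n}}),
  (forall S, Q S -> D S \subset E /\ (n * n <= c * #|D S|)%N) ->
  Pr p E (fun X => exists2 S, Q S & [disjoint X & D S]) <= e.
Proof.
move=> c0 e0; pose e' := Num.min 1 e.
have e'0 : 0 < e' by rewrite lt_min ltr01.
exists ((4 * c)%:R / e'), c => n p ltcn p01 hB E Q D hD.
have [p0 p1] := andP p01.
have n0 : (0 < n)%N by apply: leq_trans ltcn.
pose L := (n %/ c)%N; pose q := (1 - p) ^+ L.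
have L0 : (0 < L)%N by rewrite divn_gt0.
have q0 : 0 <= q by rewrite exprn_ge0 // subr_ge0.
have leL : (n <= 2 * c * L)%N.
  have := ltn_ceil n c0; rewrite -/L mulSn => h.
  have h2 : (c <= L * c)%N by rewrite leq_pmull.
  by rewrite -mulnA [(c * L)%N]mulnC mul2n -addnn (leq_trans (ltnW h)) // leq_add2r.
have Lp : 2 / e' <= L%:R * p.
  have le1 : p * n%:R <= p * (2 * c * L)%:R by rewrite ler_wpM2l // ler_nat.
  have := le_trans hB le1.
  have -> : (4 * c)%:R / e' = (2 * c)%:R * (2 / e').
    by rewrite mulrA -natrM; congr (_%:R / _); rewrite mulnAC.
  rewrite [(2 * c * L)%:R]natrM [X in _ <= X]mulrCA ler_pM2l ?ltr0n ?muln_gt0 //.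
  by rewrite [p * _]mulrC.
have q2 : 2 * q <= e'.
  have := expr_onem_le L p01; rewrite -/q => h.
  have := ler_wpM2l (ler0n R 2) h.
  move/le_trans; apply; rewrite ler_pdivrMr; last first.
    by rewrite ltr_wpDr ?mulr_ge0 ?ler0n.
  rewrite mulrC -ler_pdivrMr //; apply: le_trans Lp _.
  by rewrite lerDr ler01.
have q21 : 2 * q <= 1 by apply: le_trans q2 _; rewrite ge_min lexx.
apply: (@le_trans _ _ (\sum_(S : {set 'I_n} | Q S) Pr p E (fun X => [disjoint X & D S]))).
  apply: Pr_bigU => // X sX [S QS dis]; apply/hasP.
  by exists S; rewrite ?mem_index_enum // QS; apply/asboolP.
apply: (@le_trans _ _ (\sum_(S : {set 'I_n}) q ^+ n)).
  rewrite [leRHS](bigID Q) /= -[leLHS]addr0 lerD //; last first.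
    by apply: sumr_ge0 => S _; rewrite exprn_ge0.
  apply: ler_sum => S QS; have [sD leD] := hD S QS; rewrite Pr_avoid // -exprM.
  rewrite ler_wiXn2l ?subr_ge0 ?lerBlDr ?lerDl //.
  rewrite -(leq_pmul2l c0); apply: leq_trans leD.
  by rewrite mulnA leq_mul2r mulnC leq_trunc_div orbT.
rewrite sumr_const -cardsT -powersetT card_powerset cardsT card_ord.
rewrite -[leLHS]mulr_natl natrX -exprMn.
apply: (@le_trans _ _ (2 * q)); last by apply: le_trans q2 _; rewrite ge_min lexx orbT.
rewrite -[leRHS]expr1 ler_wiXn2l // mulr_ge0 //.
Qed.

End Avoid.

(** Averaging over a random union of components: the number of disconnected
    pairs is at most four times the number of pairs that some closed set
    separates. *)
Lemma separating_set (W : finType) (X : {set {set W}}) (A : {set W}) :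
  exists S : {set W}, (forall u v, [set u; v] \in X -> (u \in S) = (v \in S)) /\
  (#|[set u : W * W | [&& u.1 \in A, u.2 \in A & ~~ linked X u.1 u.2]]| <=
     4 * (#|A :&: S| * #|A :\: S|))%N.
Proof.
set disc := [set u | _].
pose r := fingraph.root (fun u v : W => [set u; v] \in X).
have csym : connect_sym (fun u v : W => [set u; v] \in X).
  by apply: sym_connect_sym => u v; rewrite setUC.
pose cl (T : {set W}) := [set x | r x \in T].
have clP T u v : [set u; v] \in X -> (u \in cl T) = (v \in cl T).
  move=> uv; rewrite !inE; suff -> : r u = r v by [].
  by apply/eqP; rewrite root_connect // connect1.
(* The average over all T suffices: two vertices in different components are
   separated by the union of the components with root in T for a quarter of the T. *)
suff [T leT] : exists T, (#|disc| <= 4 * (#|A :&: cl T| * #|A :\: cl T|))%N.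
  by exists (cl T); split=> //; apply: clP.
apply: contrapT => noT.
have ltT T : (4 * (#|A :&: cl T| * #|A :\: cl T|) < #|disc|)%N.
  by rewrite ltnNge; apply/negP => h; apply: noT; exists T.
have : (\sum_(T : {set W}) 4 * (#|A :&: cl T| * #|A :\: cl T|) <
    \sum_(T : {set W}) #|disc|)%N.
  rewrite (bigD1 set0) //= [ltnRHS](bigD1 set0) //= -addSn leq_add //.
  by apply: leq_sum => T _; apply: ltnW.
rewrite ltnNge => /negP; apply.
have prod T : (#|A :&: cl T| * #|A :\: cl T| =
    \sum_(u : W * W) ((u.1 \in A :&: cl T) && (u.2 \in A :\: cl T)))%N.
  rewrite -cardsX -sum1_card big_mkcond /=; apply: eq_bigr => -[u v] _ /=.
  by rewrite in_setX /=; case: (_ && _).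
under [leqRHS]eq_bigr do rewrite prod big_distrr /=.
rewrite exchange_big /= [leqLHS](_ : _ = \sum_(u in disc) #|{set W}|)%N; last first.
  by rewrite !sum_nat_const mulnC.
rewrite big_mkcond; apply: leq_sum => -[u v] _.
case: ifP => //; rewrite inE /= => /and3P [uA vA nuv].
have nr : r u != r v by rewrite root_connect.
rewrite -big_distrr /=.
have -> : (\sum_(T : {set W}) ((u \in A :&: cl T) && (v \in A :\: cl T)) =
    #|[set T : {set W} | (r u \in T) && (r v \notin T)]|)%N.
  rewrite -sum1_card [RHS]big_mkcond /=; apply: eq_bigr => T _.
  by rewrite !inE uA vA /= andbT; case: (_ && _).
pose P := powerset (~: [set r u; r v]).
have leP : (#|P| <= #|[set T : {set W} | (r u \in T) && (r v \notin T)]|)%N.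
  rewrite -(card_in_imset (f := fun T => r u |: T)); last first.
    have nu T : T \in P -> r u \notin T.
      rewrite powersetE => /subsetP sT; apply/negP => /sT.
      by rewrite !inE eqxx.
    by move=> T T' /nu TP /nu TP' e; rewrite -(setU1K TP) e setU1K.
  apply: subset_leq_card; apply/subsetP => _ /imsetP [T TP ->].
  rewrite !inE eqxx eq_sym negb_or nr /=.
  by move: TP; rewrite powersetE => /subsetP sT; apply/negP => /sT; rewrite !inE eqxx orbT.
apply: leq_trans (_ : 4 * #|P| <= _)%N; last by rewrite leq_mul2l leP orbT.
rewrite card_powerset -cardsT -powersetT card_powerset cardsT.
by rewrite -(cardsC [set r u; r v]) cards2 nr expnD.
Qed.

(** * Linking the vertices of one half through the other *)

Definition cross (W : finType) (A : {set W}) : {set {set W}} :=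
  [set [set u.1; u.2] | u in setX A (~: A)].

Lemma cross_inj (W : finType) (A : {set W}) :
  {in setX A (~: A) &, injective (fun u : W * W => [set u.1; u.2])}.
Proof.
move=> [a b] [a' b']; rewrite !inE /= => /andP [aA bA] /andP [a'A b'A] e.
have ea : a = a'.
  move/setP/(_ a): e; rewrite !inE eqxx /= => /esym/orP [] /eqP // e.
  by rewrite e (negPf b'A) in aA.
rewrite -ea in e *; congr (_, _); apply: set2_inj e _.
by apply: contraNneq bA => <-.
Qed.

Lemma card_cross_image (W : finType) (A : {set W}) (T : {set W * W}) : T \subset setX A (~: A) ->
  #|[set [set u.1; u.2] | u in T]| = #|T|.
Proof.
move=> /subsetP sT; apply: card_in_imset => u v /sT uT /sT vT.
exact: (cross_inj uT vT).
Qed.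

Lemma cross_pairs (W : finType) (A : {set W}) : cross A \subset pairs setT.
Proof.
apply/subsetP => _ /imsetP [[a b] + ->]; rewrite !inE /= => /andP [aA bA].
rewrite subsetT andbT cards2; suff -> : a != b by [].
by apply: contraNneq bA => <-.
Qed.

Lemma cross_pairs_disjoint (W : finType) (A : {set W}) : [disjoint pairs A & cross A].
Proof.
rewrite -setI_eq0; apply/eqP/setP => e; rewrite !inE.
apply/negP => /andP [/andP [_ /subsetP eA] /imsetP [[a b] + ee]].
by rewrite !inE /= => /andP [_ /negP]; apply; apply: eA; rewrite ee !inE eqxx orbT.
Qed.

(** A set splitting [A] into two large parts is crossed by many edges between
    [A] and its complement. *)
Definition split_edges (W : finType) (A S : {set W}) : {set {set W}} :=
  [set [set u.1; u.2] | u in setX (A :&: S) (~: A :\: S) :|: setX (A :\: S) (~: A :&: S)].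

Lemma split_edges_cross (W : finType) (A S : {set W}) : split_edges A S \subset cross A.
Proof.
apply: imsetS; apply/subsetP => -[a b]; rewrite !inE /=.
by case/orP => /andP [/andP [? ?] /andP [? ?]]; apply/andP.
Qed.

Lemma card_split_edges (W : finType) (A S : {set W}) :
  #|split_edges A S| =
  (#|A :&: S| * #|~: A :\: S| + #|A :\: S| * #|~: A :&: S|)%N.
Proof.
rewrite (@card_cross_image _ A); last first.
  apply/subsetP => -[a b]; rewrite !inE /=.
  by case/orP => /andP [/andP [? ?] /andP [? ?]]; apply/andP.
rewrite cardsU !cardsX [X in (_ - X)%N](_ : _ = 0%N) ?subn0 //.
apply/eqP; rewrite cards_eq0; apply/eqP/setP => -[a b]; rewrite !inE /=.
by case: (a \in S); rewrite /= ?andbF.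
Qed.

Lemma card_lower n : #|lower n| = n./2.
Proof.
rewrite -[RHS]card_ord -sum1_card -[RHS]sum1_card.
rewrite (big_ord_widen n (fun=> 1%N) (half_leqn n)).
by apply: eq_bigl => i; rewrite inE.
Qed.

(** Both parts of [lower n] have at least [n / c] vertices, and each of the at least
    [n / 2] other vertices is on one of the two sides, hence joined across to the
    part on the other side. *)
Lemma split_edges_lower n (S : {set 'I_n}) c :
  (n * n <= c * (#|lower n :&: S| * #|lower n :\: S|))%N ->
  (n * n <= (2 * c) * #|split_edges (lower n) S|)%N.
Proof.
set A := lower n; rewrite card_split_edges => h.
have cA : (#|A :&: S| + #|A :\: S| = n./2)%N by rewrite cardsID card_lower.
have cB : (#|~: A :&: S| + #|~: A :\: S| = n - n./2)%N.
  have := cardsC A; rewrite card_lower card_ord cardsID => h'.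
  by rewrite -[X in (X - _)%N]h' addKn.
move: h cA cB; move: #|_| #|_| #|_| #|_| => b2 b1 a2 a1 h cA cB.
have hn : (n <= 2 * (b1 + b2))%N by lia.
have a1n : (a1 <= n)%N by lia.
have a2n : (a2 <= n)%N by lia.
have [n0|n0] := posnP n; first by rewrite n0.
have n1 : (n <= c * a1)%N.
  rewrite -(leq_pmul2r n0); apply: leq_trans h _.
  by rewrite -mulnA leq_mul2l leq_mul2l a2n !orbT.
have n2 : (n <= c * a2)%N.
  rewrite -(leq_pmul2r n0); apply: leq_trans h _.
  by rewrite -mulnA leq_mul2l [(a1 * _)%N]mulnC leq_mul2l a1n !orbT.
apply: (@leq_trans (n * (2 * (b1 + b2)))%N); first by rewrite leq_mul2l hn orbT.
rewrite mulnCA -[(2 * c * _)%N]mulnA leq_mul2l /= mulnDr [leqLHS]addnC mulnDr leq_add //.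
  by rewrite mulnA leq_mul2r n1 orbT.
by rewrite mulnA leq_mul2r n2 orbT.
Qed.

Lemma card_distinct_pairs n : (8 <= n)%N -> (n * n <= 16 *
  #|[set u : 'I_n * 'I_n | [&& u.1 \in lower n, u.2 \in lower n & u.1 != u.2]]|)%N.
Proof.
move=> n8; set Z := [set u | _]; set A := lower n in Z *.
have : (#|setX A A| <= #|Z| + #|A|)%N.
  have -> : #|A| = #|[set (a, a) | a in A]| by rewrite card_imset // => a b [].
  apply: leq_trans (leq_card_setU _ _); apply: subset_leq_card.
  apply/subsetP => -[a b]; rewrite !inE /= => /andP [aA bA].
  have [->|ab] := eqVneq a b; last by rewrite aA bA.
  by apply/orP; right; apply/imsetP; exists b; rewrite ?inE.
rewrite cardsX card_lower; move: #|Z| => z; nia.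
Qed.

Section Relabel.
Variables (R : realType) (W : finType) (A : {set W}) (p : R).

Lemma linked_tperm (x y u v : W) : x \in A -> y \in A ->
  Pr p (cross A) (fun X => ~~ linked X u v) =
  Pr p (cross A) (fun X => ~~ linked X (tperm x y u) (tperm x y v)).
Proof.
move=> xA yA; set s := tperm x y.
have sA z : (s z \in A) = (z \in A).
  by rewrite /s; case: tpermP => // ->; rewrite xA yA.
pose h (e : {set W}) := s @: e.
have hh e : h (h e) = e.
  rewrite /h -imset_comp (eq_imset _ (g := id)) ?imset_id // => z /=.
  by rewrite /s tpermK.
have injh : injective h by apply: can_inj hh.
have hc : h @: cross A = cross A.
  have sub : h @: cross A \subset cross A.
    apply/subsetP => _ /imsetP [_ /imsetP [[a b] + ->] ->].
    rewrite !inE /= => ab; apply/imsetP; exists (s a, s b); rewrite ?inE /= ?sA //.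
    by rewrite /h imsetU1 imset_set1.
  by apply/eqP; rewrite eqEcard sub (card_imset _ injh) leqnn.
rewrite -[RHS](Pr_relabel p (fun X => ~~ linked X (s u) (s v)) injh hc).
apply: Pr_ext => X _; apply: iff_trans (iff_refl _) _.
have lk (Y : {set {set W}}) a b : linked Y a b -> linked (h @: Y) (s a) (s b).
  case/connectP => q; elim: q a => [|c q IHq] a /=; first by move=> _ ->; apply: connect0.
  move=> /andP [ac pq] eb; apply: connect_trans (IHq c pq eb).
  apply/connect1/imsetP; exists [set a; c] => //.
  by rewrite /h imsetU1 imset_set1.
have hhX : h @: (h @: X) = X.
  by rewrite -imset_comp (eq_imset _ (g := id)) ?imset_id // => z /=; rewrite hh.
suff -> : linked (h @: X) (s u) (s v) = linked X u v by [].
apply/idP/idP => [|]; last exact: lk.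
by move/lk; rewrite hhX /s !tpermK.
Qed.

(** Two transpositions of vertices of [A] move any pair to any other pair. *)
Lemma linked_symmetry (a a' b b' : W) : [&& a \in A, a' \in A, b \in A & b' \in A] ->
  a != a' -> b != b' ->
  Pr p (cross A) (fun X => ~~ linked X a a') =
  Pr p (cross A) (fun X => ~~ linked X b b').
Proof.
case/and4P => aA a'A bA b'A aa' bb'; rewrite (linked_tperm _ _ aA bA) tpermL.
set c := tperm a b a'.
have cb : c != b by rewrite -[b](tpermL a b) (inj_eq perm_inj) eq_sym.
have cA : c \in A by rewrite /c; case: tpermP.
by rewrite (linked_tperm _ _ cA b'A) tpermL tpermD // eq_sym.
Qed.

End Relabel.

Section Connectivity.
Variable R : realType.

(** Double counting: both sides are the expectation of [#|D X|]. *)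
Lemma sum_Pr_mem (T I : finType) (p : R) (E : {set T}) (D : {set T} -> {set I}) (Z : {set I}) :
  (forall X, D X \subset Z) ->
  \sum_(i in Z) Pr p E (fun X => i \in D X) =
  \sum_(X in powerset E) weight p E X * #|D X|%:R.
Proof.
move=> hD; rewrite /Pr; under eq_bigr do rewrite big_mkcondr /=.
rewrite exchange_big /=; apply: eq_bigr => X; rewrite powersetE => sX.
transitivity (\sum_(i in D X) weight p E X).
  rewrite [RHS]big_mkcond [LHS]big_mkcond /=; apply: eq_bigr => i _.
  rewrite asboolb; case: (boolP (i \in D X)) => [iD|]; last by case: ifP.
  by rewrite (subsetP (hD X)).
by rewrite sumr_const mulr_natr.
Qed.

(** If [p * n] is large then two given vertices of [lower n] are likely to be
    linked by edges between the two halves: by symmetry it suffices that few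
    pairs are not linked, and otherwise two large parts would be separated. *)
Lemma linked_lower (e : R) : 0 < e -> exists (B : R) (n0 : nat),
  forall n p, (n0 <= n)%N -> 0 <= p <= 1 -> B <= p * n%:R ->
  forall a a', a \in lower n -> a' \in lower n ->
  Pr p (cross (lower n)) (fun X => ~~ linked X a a') <= e.
Proof.
move=> e0; pose e1 := e / 32.
have e10 : 0 < e1 by rewrite divr_gt0.
pose c := (Num.truncn (4 / e1)).+1.
have c4 : 4 / e1 < c%:R by rewrite truncnS_gt.
have [B [n0 hB]] := @avoid_family R (2 * c) e1 isT e10.
exists B, (maxn n0 8) => n p; rewrite geq_max => /andP [n0n n8] p01 pB a a' aA a'A.
set A := lower n in aA a'A *.
have [<-|aa'] := eqVneq a a'.
  rewrite /Pr big_pred0 ?ltW // => X; apply/negP => /andP [_ /asboolP].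
  by rewrite /linked connect0.
pose Q (S : {set 'I_n}) := (n * n <= c * (#|A :&: S| * #|A :\: S|))%N.
have hQ := hB n p n0n p01 pB (cross A) Q (split_edges A).
have {hQ} := hQ (fun S QS => conj (split_edges_cross A S) (split_edges_lower QS)).
set bad := fun X => exists2 S, _ & _ => hbad.
pose D (X : {set {set 'I_n}}) :=
  [set u : 'I_n * 'I_n | [&& u.1 \in A, u.2 \in A & ~~ linked X u.1 u.2]].
pose Z := [set u : 'I_n * 'I_n | [&& u.1 \in A, u.2 \in A & u.1 != u.2]].
have DZ X : D X \subset Z.
  apply/subsetP => u; rewrite !inE => /and3P [-> ->] /=.
  by apply: contraNneq => ->; apply: connect0.
have n2 : 0 < (n * n)%:R :> R by rewrite ltr0n; case: (n) n8.
have := sum_Pr_mem p (cross A) DZ.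
rewrite (eq_bigr (fun=> Pr p (cross A) (fun X => ~~ linked X a a'))); last first.
  move=> [b b']; rewrite inE /= => /and3P [bA b'A bb'].
  rewrite (@linked_symmetry _ _ A p a a' b b') ?aA ?a'A ?bA //.
  by apply: Pr_ext => X _; rewrite inE /= bA b'A.
rewrite sumr_const => eqS.
have cZ : (n * n <= 16 * #|Z|)%N by apply: card_distinct_pairs.
have cD X : (#|D X| <= n * n)%N.
  by apply: leq_trans (max_card _) _; rewrite card_prod !card_ord.
have good (X : {set {set 'I_n}}) : X \subset cross A -> ~ bad X -> (c * #|D X| <= 4 * (n * n))%N.
  move=> sX nb; have [S [clS leS]] := separating_set X A.
  apply: leq_trans (leq_mul (leqnn c) leS) _; rewrite mulnCA leq_mul2l /=.
  rewrite leqNgt; apply/negP => lt; apply: nb; exists S; first exact: ltnW.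
  rewrite -setI_eq0; apply/eqP/setP => f; rewrite [f \in set0]inE; apply/negP.
  rewrite inE => /andP [fX /imsetP [[b b'] + ff]]; rewrite ff /= in fX.
  by rewrite !inE /= (clS _ _ fX); case: (b' \in S); rewrite /= ?andbF.
have le1 : \sum_(X in powerset (cross A)) weight p (cross A) X * #|D X|%:R <=
    (2 * e1) * (n * n)%:R.
  apply: (@le_trans _ _ (Pr p (cross A) bad * (n * n)%:R +
      \sum_(X in powerset (cross A)) weight p (cross A) X * (e1 * (n * n)%:R))).
    rewrite /Pr big_mkcondr mulr_suml -big_split /=; apply: ler_sum => X.
    rewrite powersetE => sX; have w0 := weight_ge0 p01 (cross A) X.
    have r0 : 0 <= weight p (cross A) X * (e1 * (n * n)%:R).
      by apply: mulr_ge0 => //; apply: mulr_ge0; rewrite ?ler0n ?(ltW e10).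
    case: asboolP => [_|nb]; first by rewrite -[leLHS]addr0 lerD // ler_wpM2l // ler_nat.
    rewrite mul0r add0r ler_wpM2l //.
    have := good X sX nb; rewrite -(ler_nat R) natrM [X in _ <= X]natrM => h.
    rewrite -(@ler_pM2l _ c%:R) ?ltr0n //; apply: le_trans h _.
    rewrite mulrA ler_wpM2r ?ler0n //.
    by rewrite ltW // -ltr_pdivrMr.
  rewrite -mulr_suml weight_sum mul1r [2 * e1]mulr_natl mulr2n mulrDl lerD2r.
  by rewrite ler_wpM2r ?ler0n.
rewrite -(ler_pM2r n2).
have P0 := Pr_ge0 p01 (cross A) (fun X => ~~ linked X a a').
apply: (@le_trans _ _ (Pr p (cross A) (fun X => ~~ linked X a a') * (16 * #|Z|)%:R)).
  by rewrite ler_wpM2l // ler_nat.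
rewrite natrM mulrCA mulr_natr eqS.
apply: le_trans (ler_wpM2l (ler0n R 16) le1) _.
by rewrite mulrA /e1 ler_wpM2r ?ler0n //; lra.
Qed.

End Connectivity.

(** * Rare subgraphs *)

Section FirstMoment.
Variable R : realType.

Lemma expn_powR (n d : nat) (m : R) (p : R) : m != 0 -> 
  (p * n%:R `^ (1 / m)) ^+ d = p ^+ d * n%:R `^ (d%:R / m).
Proof.
move=> m0; rewrite exprMn; congr (_ * _).
by rewrite -powR_mulrn ?powR_ge0 // -powRrM mulrAC mul1r.
Qed.

(** Copies of [H] restrict to copies of its subgraph [(S, D)]. *)
Lemma Pr_subcopy (V : finType) (H : sgraph V) (S : {set V}) (D : {set {set V}})
    n (p : R) :
  D \subset edges H -> (forall e, e \in D -> e \subset S) -> (0 < n)%N -> 0 <= p <= 1 ->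
  Pr p (pairs [set: 'I_n]) (fun X => exists f : V -> 'I_n, injective f /\
     forall e, e \in edges H -> f @: e \in X) <= n%:R ^+ #|S| * p ^+ #|D|.
Proof.
move=> sD DS; case: n => // n _ p01.
pose im (g : {ffun V -> 'I_n.+1}) := [set g @: e | e : {set V} in D].
pose A := [pred g : {ffun V -> 'I_n.+1} |
  (g \in pffun_on ord0 S predT) && (#|im g| == #|D|)].
have [p0 p1] := andP p01.
apply: (@le_trans _ _ (#|A|%:R * p ^+ #|D|)); last first.
  rewrite ler_wpM2r ?exprn_ge0 // -natrX ler_nat.
  apply: (@leq_trans #|pffun_on (ord0 : 'I_n.+1) S predT|); last first.
    by rewrite card_pffun_on card_ord.
  by apply: subset_leq_card; apply/subsetP => g; rewrite inE => /andP [].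
apply: (Pr_union_superset p01 (D := im)) => [X _ [f [injf fX]]|g /andP [_ /eqP]//].
pose g := [ffun x => if x \in S then f x else ord0].
have gf e : e \in D -> g @: e = f @: e.
  move=> eD; apply: eq_in_imset => x xe; rewrite ffunE.
  by rewrite (subsetP (DS e eD)).
have imf : im g = [set f @: e | e : {set V} in D] by apply: eq_in_imset.
exists g; split; last first.
  rewrite imf; apply/subsetP => _ /imsetP [e eD ->]; apply: fX.
  exact: (subsetP sD).
rewrite inE imf card_imset ?eqxx ?andbT; last exact: imset_inj.
apply/pffun_onP; split=> //; apply/subsetP => x; rewrite inE ffunE.
by case: (x \in S) => //; rewrite eqxx.
Qed.

Lemma subcopy_rare (V : finType) (H : sgraph V) (S : {set V}) (D : {set {set V}}) (m : R) :
  D \subset edges H -> (forall e, e \in D -> e \subset S) ->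
  0 < m -> #|D|%:R = m * #|S|%:R -> (0 < #|D|)%N ->
  forall e : R, 0 < e -> exists (b : R) (n0 : nat), 0 < b /\ forall n (p : R),
     (n0 <= n)%N -> 0 <= p <= 1 -> p * n%:R `^ (1 / m) <= b ->
     Pr p (pairs [set: 'I_n]) (fun X => exists f : V -> 'I_n, injective f /\
       forall e, e \in edges H -> f @: e \in X) <= e.
Proof.
move=> sD DS m0 cD D0 e e0; exists (Num.min 1 e), 1%N.
split=> [|n p n0 p01 pb]; first by rewrite lt_min ltr01.
apply: le_trans (Pr_subcopy sD DS n0 p01) _.
have -> : n%:R ^+ #|S| * p ^+ #|D| = (p * n%:R `^ (1 / m)) ^+ #|D|.
  rewrite expn_powR ?gt_eqF // mulrC cD mulrAC divff ?gt_eqF // mul1r.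
  by rewrite powR_mulrn ?ler0n.
have [p0 _] := andP p01.
have q0 : 0 <= p * n%:R `^ (1 / m) by rewrite mulr_ge0 ?powR_ge0.
apply: (@le_trans _ _ (p * n%:R `^ (1 / m))).
  rewrite -[leRHS]expr1 ler_wiXn2l //.
  by apply: le_trans pb _; rewrite ge_min lexx.
by apply: le_trans pb _; rewrite ge_min lexx orbT.
Qed.

(** Large components contain trees on [k] vertices, which are rare. *)
Lemma large_component_rare (k : nat) : (1 < k)%N ->
  forall e : R, 0 < e -> exists (b : R) (n0 : nat), 0 < b /\ forall n (p : R),
     (n0 <= n)%N -> 0 <= p <= 1 -> p * n%:R `^ (k%:R / (k%:R - 1)) <= b ->
     Pr p (pairs [set: 'I_n]) (fun X => exists w,
       (k <= #|[set u | linked X w u]|)%N) <= e.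
Proof.
move=> k1 e e0; pose c : R := (k ^ k)%:R.
have c0 : 0 < c by rewrite ltr0n expn_gt0 (ltn_trans _ k1).
exists (Num.min 1 (e / c)), 1%N.
split=> [|n p n0 p01 pb]; first by rewrite lt_min ltr01 divr_gt0.
have [p0 _] := andP p01.
(* A tree on k vertices is encoded by finite functions listing its vertices and
   parents, extended to nat by default values that are never read. *)
pose ext (T : Type) (d : T) (f : {ffun 'I_k -> T}) (i : nat) : T :=
  if insub i is Some a then f a else d.
case: n n0 pb => // n _ pb.
have k0 : (0 < k)%N := ltnW k1.
pose x0 (y : {ffun 'I_k -> 'I_n.+1} * {ffun 'I_k -> 'I_k}) := ext _ ord0 y.1.
pose j0 (y : {ffun 'I_k -> 'I_n.+1} * {ffun 'I_k -> 'I_k}) i : nat := ext _ (Ordinal k0) y.2 i.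
pose A := [pred y | #|tree_edges (x0 y) (j0 y) k| == k.-1].
apply: (@le_trans _ _ (#|A|%:R * p ^+ k.-1)).
  apply: (Pr_union_superset p01 (D := fun y => tree_edges (x0 y) (j0 y) k)).
    move=> X _ [w kw]; have [x [j [injx ltj sX]]] := linked_tree k0 kw.
    pose y := ([ffun i : 'I_k => x i],
      [ffun i : 'I_k => insubd (Ordinal k0) (j i)] : {ffun 'I_k -> 'I_k}).
    have xE i : (i < k)%N -> x0 y i = x i.
      by move=> li; rewrite /x0 /ext insubT /= ffunE.
    have jE i : (0 < i < k)%N -> j0 y i = j i.
      move=> /andP [i0 li]; rewrite /j0 /ext insubT /= ffunE val_insubd.
      by rewrite (ltn_trans (ltj i i0) li).
    have tE : tree_edges (x0 y) (j0 y) k = tree_edges x j k.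
      apply: eq_imset => i; have li : (i.+1 < k)%N by rewrite -ltn_predRL.
      by rewrite xE // jE ?li // xE // (ltn_trans (ltj _ _) li).
    by exists y; rewrite inE tE card_tree_edges.
  by move=> y /eqP.
have cA : (#|A| <= n.+1 ^ k * k ^ k)%N.
  by apply: leq_trans (max_card _) _; rewrite card_prod !card_ffun !card_ord.
apply: (@le_trans _ _ ((n.+1 ^ k * k ^ k)%:R * p ^+ k.-1)).
  by rewrite ler_wpM2r ?exprn_ge0 // ler_nat.
set q := p * _ in pb.
have k1E : k%:R - 1 = k.-1%:R :> R by rewrite -{1}(prednK k0) -natr1 addrK.
have kn0 : k.-1%:R != 0 :> R by rewrite pnatr_eq0; lia.
have -> : (n.+1 ^ k * k ^ k)%:R * p ^+ k.-1 = c * q ^+ k.-1.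
  rewrite natrM -/c mulrAC mulrC; congr (_ * _); rewrite /q exprMn mulrC.
  congr (_ * _); rewrite -[RHS]powR_mulrn ?powR_ge0 // -powRrM k1E.
  by rewrite divfK // powR_mulrn ?ler0n // natrX.
have q0 : 0 <= q by rewrite mulr_ge0 ?powR_ge0.
rewrite mulrC -ler_pdivlMr //.
apply: (@le_trans _ _ q).
  rewrite -[leRHS]expr1 ler_wiXn2l //; last by lia.
  by apply: le_trans pb _; rewrite ge_min lexx.
by apply: le_trans pb _; rewrite ge_min lexx orbT.
Qed.

(** The expected number of cycles is at most the sum of [(n * p) ^ l] over all
    lengths [l]. *)
Lemma cycles_rare (e : R) : 0 < e -> exists (b : R) (n0 : nat), 0 < b /\ forall n (p : R),
  (n0 <= n)%N -> 0 <= p <= 1 -> p * n%:R <= b ->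
  Pr p (pairs [set: 'I_n]) (fun X => exists2 G, edges G = X & ~ is_forest G) <= e.
Proof.
move=> e0; pose b := Num.min (1 / 2) (e / 4).
have b0 : 0 < b by rewrite lt_min !divr_gt0.
exists b, 1%N; split=> // -[//|n] p _ p01 pb; have [p0 _] := andP p01.
pose C (l : nat) (t : l.-tuple 'I_n.+1) := cycle_edges ord0 t.
pose Q (l : 'I_n.+2) (X : {set {set 'I_n.+1}}) :=
  exists t : l.-tuple 'I_n.+1, uniq t /\ C l t \subset X.
apply: (@le_trans _ _ (\sum_(l < n.+2 | (2 < l)%N) Pr p (pairs [set: 'I_n.+1]) (Q l))).
  apply: Pr_bigU => // X _ [G <- nf].
  have [s [/andP [cs us] ls]] : exists s, ucycle (adj G) s /\ (2 < size s)%N.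
    apply: contrapT => h; apply: nf => s ucs; rewrite ltnNge; apply/negP => ls.
    by apply: h; exists s.
  have lsn : (size s < n.+2)%N.
    by rewrite ltnS -(card_uniqP us) -[X in (_ <= X)%N]card_ord max_card.
  apply/hasP; exists (Ordinal lsn); rewrite ?mem_index_enum //= ls.
  apply/asboolP; exists (in_tuple s); split=> //.
  by apply: cycle_edges_sub cs _; apply: ltnW.
apply: (@le_trans _ _ (\sum_(l < n.+2) (2 * b) * (1 / 2) ^+ l)).
  rewrite big_mkcond; apply: ler_sum => l _; case: ifP => [l2|_]; last first.
    by rewrite mulr_ge0 ?exprn_ge0 ?divr_ge0 // mulr_ge0 // ltW.
  apply: (@le_trans _ _ (#|[pred t : l.-tuple 'I_n.+1 | uniq t]|%:R * p ^+ l)).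
    apply: (Pr_union_superset p01 (D := @C l)) => [X _ [t [ut sX]]|t ut].
      by exists t.
    by rewrite card_cycle_edges ?size_tuple.
  apply: (@le_trans _ _ ((p * n.+1%:R) ^+ l)).
    rewrite exprMn mulrC ler_wpM2l ?exprn_ge0 // -natrX ler_nat.
    by apply: leq_trans (max_card _) _; rewrite card_tuple card_ord.
  have q0 : 0 <= p * n.+1%:R by rewrite mulr_ge0 ?ler0n.
  have hq : p * n.+1%:R <= 1 / 2 by apply: le_trans pb _; rewrite ge_min lexx.
  rewrite -(prednK (ltn_trans (ltn0Sn 1) l2)) !exprS mulrA.
  have -> : 2 * b * (1 / 2) = b by field.
  rewrite ler_pM ?exprn_ge0 //.
  by rewrite lerXn2r ?nnegrE // divr_ge0.
rewrite -mulr_sumr.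
have geo k : \sum_(l < k) ((1 / 2) ^+ l : R) <= 2.
  suff -> : \sum_(l < k) ((1 / 2) ^+ l : R) = 2 - 2 * (1 / 2) ^+ k.
    by rewrite lerBlDr lerDl mulr_ge0 ?exprn_ge0 ?divr_ge0.
  elim: k => [|k IHk]; first by rewrite big_ord0 expr0; ring.
  by rewrite big_ord_recr /= IHk exprS; field.
have b2 : 0 <= 2 * b by rewrite mulr_ge0 // ltW.
apply: le_trans (ler_wpM2l b2 (geo _)) _.
have : b <= e / 4 by rewrite ge_min lexx orbT.
lra.
Qed.

End FirstMoment.

(** * Maximum density *)

Section Density.
Variables (R : realType) (V : finType) (H : sgraph V).
Let m := max_density R H.

Lemma density_ge (S : {set V}) (D : {set {set V}}) :
  D \subset edges H -> (forall e, e \in D -> e \subset S) -> S != set0 ->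
  #|D|%:R / #|S|%:R <= m.
Proof.
move=> sD DS S0; rewrite /m /max_density.
have := @le_bigmax_cond _ R _ 0 (S, D)
  (fun J => is_subgraph J H && (J.1 != set0)) (fun J => #|J.2|%:R / #|J.1|%:R).
apply; rewrite S0 andbT /is_subgraph /= sD; exact/forall_inP.
Qed.

Lemma inside_density (S : {set V}) : #|inside H S|%:R <= m * #|S|%:R.
Proof.
have sub : inside H S \subset edges H by apply/subsetP => e; rewrite inE => /andP [].
have subS e : e \in inside H S -> e \subset S by rewrite inE => /andP [].
have [S0|S0] := eqVneq S set0.
  suff -> : inside H S = set0 by rewrite S0 !cards0 mulr0.
  apply/setP => e; rewrite !inE S0 subset0; apply/negP => /andP [eH /eqP e0].
  by have := edge_card eH; rewrite e0 cards0.
by rewrite -ler_pdivrMr ?density_ge // ltr0n card_gt0.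
Qed.

Lemma density_ge_half : (0 < num_edges H)%N -> 1 / 2 <= m.
Proof.
case/card_gt0P => e eH; have c2 := edge_card eH.
have := @density_ge e [set e]; rewrite cards1 c2; apply.
- by rewrite sub1set.
- by move=> e'; rewrite inE => /eqP ->.
- by rewrite -card_gt0 c2.
Qed.

Lemma density_attained : (0 < num_edges H)%N -> exists (S : {set V}) (D : {set {set V}}),
  [/\ D \subset edges H, forall e, e \in D -> e \subset S, (0 < #|D|)%N &
      #|D|%:R = m * #|S|%:R].
Proof.
move=> eH; have m2 := density_ge_half eH.
have /card_gt0P [e /edge_adj [u _]] := eH.
pose P (J : {set V} * {set {set V}}) := is_subgraph J H && (J.1 != set0).
have P0 : P ([set u], set0).
  rewrite /P /is_subgraph /= sub0set /= -card_gt0 cards1 andbT.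
  by apply/forall_inP => e'; rewrite inE.
have mE := @bigmax_eq_arg _ R _ 0 _ P (fun J => #|J.2|%:R / #|J.1|%:R) P0
  (fun J _ => divr_ge0 (ler0n R _) (ler0n R _)).
move: mE; case: arg_maxP => // -[S D] /andP [/andP [/= sD /forall_inP DS] S0] _ mE.
have {}mE : m = #|D|%:R / #|S|%:R := mE.
exists S, D; split=> //.
  rewrite lt0n; apply/negP => /eqP D0; move: m2.
  by rewrite mE D0 mul0r; apply/negP; rewrite -ltNge divr_gt0.
by rewrite mE divfK // pnatr_eq0 cards_eq0.
Qed.

(** A cycle has as many edges as vertices. *)
Lemma density_ge1 : ~ is_forest H -> 1 <= m.
Proof.
move=> nf.
have [s [/andP [cs us] ls]] : exists s, ucycle (adj H) s /\ (2 < size s)%N.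
  apply: contrapT => h; apply: nf => s ucs; rewrite ltnNge; apply/negP => ls.
  by apply: h; exists s.
have /hasP [v0 _ _] : has predT s by rewrite has_predT (leq_trans _ ls).
have := @density_ge [set x in s] (cycle_edges v0 s).
have -> : #|[set x in s]| = size s by rewrite cardsE; apply/card_uniqP.
rewrite card_cycle_edges // divff ?pnatr_eq0; last by case: (s) ls.
apply.
- by apply: cycle_edges_sub cs _; apply: ltnW.
- by move=> e; apply: cycle_edges_in; apply: ltn_trans ls.
- by rewrite -card_gt0 cardsE (card_uniqP us) (ltn_trans _ ls).
Qed.

End Density.

(** In the order given by [forest_order] every vertex but the first has a parent,
    and the edges to all these parents form a tree. *)
Lemma forest_in_tree (V : finType) (H : sgraph V) (v0 : V) : is_forest H ->
  exists (T : sgraph V) (x : nat -> V) (j : nat -> nat),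
  [/\ edges T = tree_edges x j #|nonisolated H|, edges H \subset edges T,
      {in gtn #|nonisolated H| &, injective x} &
      (forall i, (0 < i)%N -> (j i < i)%N)].
Proof.
move=> fH; have [s [j [us sN ltj js]]] := forest_order fH v0 (nonisolated H).
have ck : #|nonisolated H| = size s by rewrite -(eq_card sN); apply/card_uniqP.
pose x := nth v0 s.
have injx : {in gtn #|nonisolated H| &, injective x}.
  by move=> a b; rewrite ck !inE => la lb /eqP; rewrite nth_uniq // => /eqP.
have [|T TE] := @pairs_graph V (tree_edges x j #|nonisolated H|).
  apply/subsetP => _ /imsetP [i _ ->]; rewrite inE subsetT andbT cards2.
  have li : (i.+1 < #|nonisolated H|)%N by rewrite -ltn_predRL.
  have lj := ltj i.+1 (ltn0Sn i).
  have : x i.+1 != x (j i.+1).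
    apply/eqP => /injx; rewrite !inE => /(_ li (ltn_trans lj li)) e.
    by move: lj; rewrite -e ltnn.
  by move=> ->.
exists T, x, j; split=> //; rewrite TE; apply/subsetP => e /edge_adj [u [v [-> uv]]].
have ins w w' : adj H w w' -> w \in s.
  by move=> ww; rewrite sN inE; apply/existsP; exists w'.
wlog lt : u v uv / (index u s < index v s)%N.
  move=> wlg; case: (ltngtP (index u s) (index v s)) => lt.
  - exact: wlg.
  - by rewrite setUC; apply: wlg => //; rewrite adj_sym.
  - have := adj_neq uv; rewrite -(nth_index v0 (ins _ _ uv)) lt nth_index ?eqxx //.
    by apply: (ins _ u); rewrite adj_sym.
have vs : v \in s by apply: (ins _ u); rewrite adj_sym.
have us' := ins _ _ uv.
have ji : index u s = j (index v s).
  by apply: js; rewrite ?nth_index // lt index_mem.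
have li : (index v s < size s)%N by rewrite index_mem.
have lp : ((index v s).-1 < #|nonisolated H|.-1)%N by rewrite ck; lia.
apply/imsetP; exists (Ordinal lp) => //=.
by rewrite prednK ?(leq_ltn_trans _ lt) // -ji /x !nth_index // setUC.
Qed.

(** A set containing [a <= k] vertices of the tree spans at most [a - 1] edges, and
    [(a - 1) / a] is increasing in [a]. *)
Lemma tree_density (R : realType) (V : finType) (T : sgraph V) (x : nat -> V) j k :
  edges T = tree_edges x j k -> (1 < k)%N -> {in gtn k &, injective x} ->
  (forall i, (0 < i)%N -> (j i < i)%N) ->
  forall S : {set V}, #|inside T S|%:R <= (k%:R - 1) / k%:R * #|S|%:R :> R.
Proof.
move=> TE k1 injx ltj S; have := tree_edges_inside x k ltj S.
rewrite -TE -/(inside T S); set a := #|[set _ | _ \in _]| => le.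
have aS : (a <= #|S|)%N.
  have -> : a = #|[set x (val i) | i in [set i : 'I_k | x i \in S]]|.
    rewrite card_in_imset // => u v _ _ /injx h; apply/val_inj/h; rewrite inE; exact: ltn_ord.
  by apply: subset_leq_card; apply/subsetP => _ /imsetP [i + ->]; rewrite inE.
have ak : (a <= k)%N by apply: leq_trans (max_card _) _; rewrite card_ord.
have k0 : 0 < k%:R :> R by rewrite ltr0n ltnW.
rewrite mulrAC ler_pdivlMr //.
have kE : k%:R - 1 = k.-1%:R :> R by rewrite -{1}(prednK (ltnW k1)) -natr1 addrK.
rewrite kE -!natrM ler_nat.
apply: (@leq_trans (a.-1 * k)%N); first by rewrite leq_mul2r le orbT.
have h b c : (b <= c)%N -> (b.-1 * c <= c.-1 * b)%N.
  case: b c => [|b] [|c] //=; rewrite ltnS => bc.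
  by rewrite !mulnS [(b * c)%N]mulnC leq_add2r.
by apply: leq_trans (h a k ak) _; rewrite leq_mul2l aS orbT.
Qed.

(** * The threshold for the mixed Ramsey property *)

Section Halves.
Variables (R : realType) (V1 V2 : finType) (H1 : sgraph V1) (H2 : sgraph V2).

Let arrow n := fun X : {set {set 'I_n}} => exists2 G, edges G = X & mr_arrow G H1 H2.
Let noarrow n := fun X : {set {set 'I_n}} => exists2 G, edges G = X & ~ mr_arrow G H1 H2.

(** With [p * n] large every set of linear size spans an edge, which is all that
    the construction of a rainbow forest needs. *)
Lemma matching_arrow_likely (e : R) : is_matching H1 -> is_forest H2 -> 0 < e ->
  exists (B : R) (n0 : nat), forall n (p : R),
    (n0 <= n)%N -> 0 <= p <= 1 -> B <= p * n%:R ->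
    Pr p (pairs [set: 'I_n]) (@noarrow n) <= e.
Proof.
move=> m1 f2 e0; pose k := #|V2|; pose d := (k + k * (2 * num_edges H1)).+1.
(* Sets of n / c vertices span edges, with c so large that the loss
   2 * d * (n / c).+1 * k of rainbow_forest is below n. *)
pose c := (4 * d * k).+1.
have [B [n0 hB]] := @avoid_family R (4 * c ^ 2) e isT e0.
exists B, (maxn n0 (maxn #|V1| c.+1)) => n p.
rewrite !geq_max => /and3P [n0n V1n cn] p01 pB.
pose Q (S : {set 'I_n}) := (n <= c * #|S|)%N.
apply: le_trans (hB n p n0n p01 pB (pairs setT) Q (fun S => pairs S) _); last first.
  move=> S QS; split.
    by apply/subsetP => f; rewrite !inE subsetT andbT => /andP [].
  have -> : #|pairs S| = 'C(#|S|, 2).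
    by rewrite -cards_draws; apply: eq_card => f; rewrite !inE andbC.
  have s2 : (2 <= #|S|)%N.
    have := leq_trans cn QS; rewrite -[X in (X < _)%N]muln1 ltn_pmul2l //.
  rewrite bin2; apply: (@leq_trans ((c * #|S|) * (c * #|S|))%N); first exact: leq_mul.
  rewrite mulnACA -mulnn [X in (_ <= X)%N]mulnAC -[X in (X <= _)%N]mulnC leq_mul2r.
  apply/orP; right; move: #|S| s2 => s; clear; nia.
apply: Pr_le => // X _ [G GX narr]; apply: contrapT => nhit; apply: narr => col.
have [mono|nomono] := pselect (monochromatic_copy G col H1); [by left|right].
apply: (@rainbow_forest V1 V2 _ H1 H2 G col (n %/ c).+1) => //.
- move=> Z ltZ; apply: contrapT => nospan; apply: nhit; exists Z.
    rewrite /Q mulnC; apply: ltnW; apply: (@leq_trans ((n %/ c).+1 * c)%N); first exact: ltn_ceil.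
    by rewrite leq_mul2r ltZ orbT.
  rewrite -setI_eq0; apply/eqP/setP => f; rewrite in_set0; apply/negP.
  rewrite !inE => /andP [fX /andP [_ fZ]]; apply: nospan; exists f => //.
  by rewrite GX.
- by rewrite card_ord.
- rewrite card_ord -/k -/d.
  have h : (4 * d * k * (n %/ c) <= n)%N.
    apply: leq_trans (leq_trunc_div n c).
    by rewrite mulnC leq_mul2l orbC leqnSn.
  have h2 : (4 * d * k < n)%N by apply: ltn_trans cn.
  have -> : (2 * d * (n %/ c).+1 * k = 2 * d * k * (n %/ c) + 2 * d * k)%N.
    by rewrite mulnAC mulnS addnC.
  rewrite -(ltn_pmul2l (isT : (0 < 2)%N)) mulnDr.
  have e4 : (2 * (2 * d * k) = 4 * d * k)%N by rewrite !mulnA.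
  by rewrite mulnA e4 mul2n -addnn -addnS leq_add.
Qed.

(** The random graph is likely to be a forest, and forests have colourings that
    avoid both a monochromatic matching and a rainbow [H2]. *)
Lemma matching_arrow_rare (e : R) : (1 < num_edges H1)%N -> is_matching H1 ->
  is_forest H2 -> ~ is_short_forest H2 -> 0 < e ->
  exists (b : R) (n0 : nat), 0 < b /\ forall n (p : R),
    (n0 <= n)%N -> 0 <= p <= 1 -> p * n%:R <= b ->
    Pr p (pairs [set: 'I_n]) (@arrow n) <= e.
Proof.
move=> e1 m1 f2 nsf e0; have [b [n0 [b0 hb]]] := cycles_rare e0.
exists b, n0; split=> // n p n0n p01 pb.
apply: le_trans (hb n p n0n p01 pb); apply: Pr_le => // X _ [G GX arr].
exists G => // fG; case: (short_forest_or f2 nsf).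
  by move=> h; apply: (forest_no_path4_arrow fG e1 m1 h arr).
by move=> h; apply: (forest_no_claw_arrow fG e1 m1 h arr).
Qed.

(** A graph that arrows contains [H1], as its edges may all have one colour. *)
Lemma arrow_rare_density (e : R) : (0 < num_edges H1)%N -> (1 < num_edges H2)%N -> 0 < e ->
  exists (b : R) (n0 : nat), 0 < b /\ forall n (p : R),
    (n0 <= n)%N -> 0 <= p <= 1 -> p * n%:R `^ (1 / max_density R H1) <= b ->
    Pr p (pairs [set: 'I_n]) (@arrow n) <= e.
Proof.
move=> e1 e2 e0; have [S [D [sD DS D0 cD]]] := density_attained R e1.
have m0 : 0 < max_density R H1.
  by apply: lt_le_trans (density_ge_half R e1); rewrite divr_gt0.
have [b [n0 [b0 hb]]] := subcopy_rare sD DS m0 cD D0 e0.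
exists b, n0; split=> // n p n0n p01 pb.
apply: le_trans (hb n p n0n p01 pb); apply: Pr_le => // X _ [G GX arr].
by have [f [injf fG]] := arrow_contains e2 arr; exists f; rewrite -GX.
Qed.

(** A copy of [H1] in one half and an edge in the other half: without a rainbow
    two-edge matching, all edges of the copy have the colour of that edge. *)
Lemma two_matching_arrow_likely (e : R) : (0 < num_edges H1)%N -> is_matching H2 ->
  num_edges H2 = 2%N -> 0 < e ->
  exists (B : R) (n0 : nat), forall n (p : R),
    (n0 <= n)%N -> 0 <= p <= 1 -> B <= p * n%:R `^ (1 / max_density R H1) ->
    Pr p (pairs [set: 'I_n]) (@noarrow n) <= e.
Proof.
move=> e1 m2 c2 e0; have m2' := density_ge_half R e1.
set m := max_density R H1 in m2' *.
have m0 : 0 < m by apply: lt_le_trans m2'; rewrite divr_gt0.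
have e20 : 0 < e / 2 by rewrite divr_gt0.
have [B [n0 hB]] := containment e1 m0 (@inside_density R V1 H1) e20.
exists (Num.max B (32 / e)), (maxn n0 (maxn #|V2| 6)) => n p.
rewrite !geq_max => /and3P [n0n V2n n6] p01 pB; have [p0 p1] := andP p01.
set A := lower n.
have sA : pairs A \subset pairs setT.
  by apply/subsetP => f; rewrite !inE subsetT andbT => /andP [].
have sA' : pairs (~: A) \subset pairs setT.
  by apply/subsetP => f; rewrite !inE subsetT andbT => /andP [].
apply: (@le_trans _ _ (e / 2 + e / 2)); last by lra.
pose copy (X : {set {set 'I_n}}) := exists f : V1 -> 'I_n, [/\ injective f,
  forall x, f x \in A & forall d, d \in edges H1 -> f @: d \in X].
apply: (@le_trans _ _ (Pr p (pairs setT) (fun X => ~ copy (X :&: pairs A)) +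
   Pr p (pairs setT) (fun X => [disjoint X & pairs (~: A)]))).
  apply: PrU => // X _ [G GX narr].
  have [[f [injf fA fX]]|] := pselect (copy (X :&: pairs A)); [right|by left].
  apply/negPn/negP; rewrite -setI_eq0 => /set0Pn [e' ]; rewrite !inE.
  move=> /andP [e'X /andP [_ e'A]]; apply: narr.
  apply: (@arrow_two_matching _ _ _ H1 H2 G f e') => //.
  - by rewrite card_ord.
  - by split=> // d /fX; rewrite inE -GX => /andP [].
  - by rewrite GX.
  - move=> d dH; apply: disjointWl e'A _; rewrite -setI_eq0.
    apply/eqP/setP => z; rewrite [RHS]inE; apply/negP; rewrite !inE.
    move=> /andP [zA /imsetP [y _ zy]].
    by move: zA; rewrite -leqNgt zy; have := fA y; rewrite inE ltnNge => /negP.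
apply: lerD.
  rewrite (Pr_marginal p (fun X => ~ copy X)) //; apply: hB => //.
  by apply: le_trans pB; rewrite le_max lexx.
rewrite Pr_avoid //; set M := #|pairs _|.
apply: le_trans (expr_onem_le M p01) _.
have hM : (n * n <= 16 * M)%N.
  have -> : M = 'C(#|~: A|, 2).
    by rewrite -cards_draws; apply: eq_card => f; rewrite !inE andbC.
  have := cardsC A; rewrite card_lower card_ord bin2; move: #|~: A| => s h.
  have h2 : (n <= 2 * s)%N by move: h; clear; lia.
  have s3 : (2 < s)%N by move: h2 n6; clear; lia.
  by apply: leq_trans (leq_mul h2 h2) _; move: s3; clear; nia.
have n1 : 1 <= n%:R :> R by rewrite ler1n (leq_trans _ n6).
have hp : 32 / e <= p * (n * n)%:R.
  apply: (@le_trans _ _ (p * n%:R `^ (1 / m))).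
    by apply: le_trans pB; rewrite le_max lexx orbT.
  rewrite ler_wpM2l // mulnn natrX -powR_mulrn ?ler0n // ler_powR //.
  by rewrite ler_pdivrMr // mulrC -ler_pdivrMr.
have hp2 : 2 / e <= M%:R * p.
  have : p * (n * n)%:R <= p * (16 * M)%:R by rewrite ler_wpM2l // ler_nat.
  move/(le_trans hp); rewrite natrM => h.
  have e32 : 32 / e = 16 * (2 / e) by field; rewrite gt_eqF.
  by move: h; rewrite e32 [p * _]mulrCA ler_pM2l // [p * _]mulrC.
rewrite -[leRHS]invrK lef_pV2 ?posrE ?invr_gt0 //; last first.
  by rewrite ltr_wpDr ?mulr_ge0 ?ler0n.
by rewrite invf_div; apply: le_trans hp2 _; rewrite lerDr ler01.
Qed.

(** A copy of [H1] in one half whose vertices are linked through the other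
    half; the two events depend on disjoint sets of edges. *)
Lemma cherry_arrow_likely (e : R) : (0 < num_edges H1)%N -> is_cherry H2 ->
  1 <= max_density R H1 -> 0 < e ->
  exists (B : R) (n0 : nat), forall n (p : R),
    (n0 <= n)%N -> 0 <= p <= 1 -> B <= p * n%:R `^ (1 / max_density R H1) ->
    Pr p (pairs [set: 'I_n]) (@noarrow n) <= e.
Proof.
move=> e1 ch m1 e0; set m := max_density R H1 in m1 *.
have m0 : 0 < m by apply: lt_le_trans m1.
have v0 : (0 < #|V1|)%N.
  by case/card_gt0P: e1 => d /edge_adj [u _]; apply/card_gt0P; exists u.
pose v2 : R := (#|V1| * #|V1|)%:R.
have v20 : 0 < v2 by rewrite ltr0n muln_gt0 v0.
have e20 : 0 < e / 2 by rewrite divr_gt0.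
have e30 : 0 < e / 2 / v2 by rewrite divr_gt0.
have [B [n0 hB]] := containment e1 m0 (@inside_density R V1 H1) e20.
have [B' [n0' hB']] := linked_lower e30.
exists (Num.max B B'), (maxn (maxn n0 n0') (maxn #|V2| 1)) => n p.
rewrite !geq_max => /andP [/andP [n0n n0n'] /andP [V2n n1]] p01 pB.
have [p0 p1] := andP p01; set A := lower n.
have pB1 : B' <= p * n%:R.
  apply: (@le_trans _ _ (p * n%:R `^ (1 / m))).
    by apply: le_trans pB; rewrite le_max lexx orbT.
  rewrite ler_wpM2l // -[leRHS]powRr1 ?ler0n // ler_powR ?ler1n //.
  by rewrite ler_pdivrMr // mul1r.
have sA : pairs A \subset pairs setT.
  by apply/subsetP => f; rewrite !inE subsetT andbT => /andP [].
pose copy (X : {set {set 'I_n}}) (f : V1 -> 'I_n) := [/\ injective f,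
  forall x, f x \in A & forall d, d \in edges H1 -> f @: d \in X].
pose Q1 X := ~ exists f, copy X f.
pose Q2 X Y := ~ exists f, copy X f /\ forall u v, linked Y (f u) (f v).
have st := @Pr_two_stage R _ p p01 (pairs setT) (pairs A) (cross A) Q1 Q2 (e / 2) (e / 2)
  sA (cross_pairs A) (cross_pairs_disjoint A).
apply: (@le_trans _ _ (e / 2 + e / 2)); last by lra.
apply: le_trans (st _ _ _); rewrite ?(ltW e20) //; first last.
- move=> X _ /contrapT [f cf].
  apply: (@le_trans _ _ (\sum_(u : V1 * V1)
     Pr p (cross A) (fun Y => ~~ linked Y (f u.1) (f u.2)))).
    apply: Pr_bigU => // Y _ nq; apply/hasP.
    have [u nu] : exists u : V1 * V1, ~~ linked Y (f u.1) (f u.2).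
      apply: contrapT => h; apply: nq; exists f; split=> // u v.
      by apply/negPn/negP => nl; apply: h; exists (u, v).
    by exists u; rewrite ?mem_index_enum //=; apply/asboolP.
  apply: (@le_trans _ _ (\sum_(u : V1 * V1) e / 2 / v2)).
    by apply: ler_sum => u _; case: cf => _ fA _; apply: hB'.
  rewrite sumr_const card_prod -[leLHS]mulr_natl -/v2 mulrC divfK //.
  by rewrite gt_eqF.
- by apply: hB => //; apply: le_trans pB; rewrite le_max lexx.
apply: Pr_le => // X _ [G GX narr].
have [h|] := pselect (exists f, copy (X :&: pairs A) f); [right|by left].
case=> f [[injf fA fX] lk]; apply: narr.
apply: (@arrow_linked _ _ _ H1 H2 G ch f); first by rewrite card_ord.
  by split=> // d /fX; rewrite inE -GX => /andP [].
move=> u v _ _; apply: linkedS (lk u v); rewrite GX; exact: subsetIl.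
Qed.

(** A tree on the non-isolated vertices of [H1] makes them lie in one
    component. *)
Lemma forest_arrow_likely (e : R) k : (0 < num_edges H1)%N -> is_cherry H2 ->
  is_forest H1 -> #|nonisolated H1| = k -> (1 < k)%N -> 0 < e ->
  exists (B : R) (n0 : nat), forall n (p : R),
    (n0 <= n)%N -> 0 <= p <= 1 -> B <= p * n%:R `^ (k%:R / (k%:R - 1)) ->
    Pr p (pairs [set: 'I_n]) (@noarrow n) <= e.
Proof.
move=> e1 ch f1 ck k1 e0.
have /card_gt0P [d0 /edge_adj [v0 _]] := e1.
have [T [x [j [TE sT injx ltj]]]] := forest_in_tree v0 f1.
rewrite ck in TE injx.
have k0 : 0 < k%:R - 1 :> R by rewrite subr_gt0 ltr1n.
have kk : 0 < k%:R :> R by rewrite ltr0n ltnW.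
have eT : (0 < num_edges T)%N by apply: leq_trans e1 (subset_leq_card sT).
have m0 : 0 < (k%:R - 1) / k%:R :> R by apply: divr_gt0.
have [B [n0 hB]] := containment eT m0 (@tree_density R _ _ _ _ _ TE k1 injx ltj) e0.
exists B, (maxn n0 #|V2|) => n p; rewrite geq_max => /andP [n0n V2n] p01 pB.
set A := lower n.
have sA : pairs A \subset pairs setT.
  by apply/subsetP => f; rewrite !inE subsetT andbT => /andP [].
have pB' : B <= p * n%:R `^ (1 / ((k%:R - 1) / k%:R)) by rewrite div1r invf_div.
apply: le_trans (hB n p n0n p01 pB').
rewrite -(Pr_marginal p _ sA); apply: Pr_le => // X _ [G GX narr] [f [injf fA fX]].
have fT d : d \in edges T -> f @: d \in edges G.
  by move=> /fX; rewrite inE -GX => /andP [].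
apply: narr; apply: (@arrow_linked _ _ _ H1 H2 G ch f); first by rewrite card_ord.
  by split=> // d dH; apply/fT/(subsetP sT).
have sfT : tree_edges (f \o x) j k \subset edges G.
  apply/subsetP => _ /imsetP [i _ ->] /=.
  have := fT [set x i.+1; x (j i.+1)]; rewrite imsetU1 imset_set1; apply.
  by rewrite TE; apply/imsetP; exists i.
have xN u : u \in nonisolated H1 -> exists2 i, (i < k)%N & x i = u.
  rewrite nonisolatedE => /bigcupP [d dH ud].
  have := subsetP sT _ dH; rewrite TE => /imsetP [i _ di].
  have li : (i.+1 < k)%N by rewrite -ltn_predRL.
  move: ud; rewrite di !inE => /orP [] /eqP ->; first by exists i.+1.
  by exists (j i.+1) => //; apply: ltn_trans (ltj _ _) li.
move=> u v /xN [a la <-] /xN [b lb <-].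
exact: (tree_linked ltj sfT).
Qed.

(** When [G] arrows, the non-isolated vertices of some copy of [H1] lie in one
    component. *)
Lemma forest_arrow_rare (e : R) k : is_cherry H2 ->
  #|nonisolated H1| = k -> (1 < k)%N -> 0 < e ->
  exists (b : R) (n0 : nat), 0 < b /\ forall n (p : R),
    (n0 <= n)%N -> 0 <= p <= 1 -> p * n%:R `^ (k%:R / (k%:R - 1)) <= b ->
    Pr p (pairs [set: 'I_n]) (@arrow n) <= e.
Proof.
move=> ch ck k1 e0; have [b [n0 [b0 hb]]] := large_component_rare k1 e0.
exists b, n0; split=> // n p n0n p01 pb.
apply: le_trans (hb n p n0n p01 pb); apply: Pr_le => // X _ [G GX arr].
have [f [[injf _] lk]] := linked_of_arrow ch arr.
have /card_gt0P [u uN] : (0 < #|nonisolated H1|)%N by rewrite ck ltnW.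
exists (f u); rewrite -ck -(card_imset _ injf); apply: subset_leq_card.
by apply/subsetP => _ /imsetP [v vN ->]; rewrite inE -GX lk.
Qed.

End Halves.

Theorem proposition1p2 (R : realType) (V1 V2 : finType)
    (H1 : sgraph V1) (H2 : sgraph V2) :
  is_forest H2 -> (2 <= minn (num_edges H1) (num_edges H2))%N ->
  [/\ is_matching H1 -> ~ is_short_forest H2 ->
        is_threshold (fun n : nat => (n%:R : R) `^ (- 1))
          (fun n (G : sgraph 'I_n) => mr_arrow G H1 H2),
      (~ is_forest H1 /\ is_cherry H2) \/
      (is_matching H2 /\ num_edges H2 = 2%N) ->
        is_threshold (fun n : nat => (n%:R : R) `^ (- (1 / max_density R H1)))
          (fun n (G : sgraph 'I_n) => mr_arrow G H1 H2)
    & forall k : nat, is_forest H1 -> #|nonisolated H1| = k -> is_cherry H2 ->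
        is_threshold
          (fun n : nat => (n%:R : R) `^ (- (k%:R / (k%:R - 1))))
          (fun n (G : sgraph 'I_n) => mr_arrow G H1 H2)].
Proof.
move=> f2; rewrite leq_min => /andP [e1 e2]; have e1' := ltnW e1.
have m0 : 0 < max_density R H1.
  by apply: lt_le_trans (density_ge_half R e1'); rewrite divr_gt0.
split.
- move=> m1 nsf; apply: (@threshold_intro R _ 1) => // e e0.
    have [B [n0 hB]] := matching_arrow_likely m1 f2 e0.
    exists B, n0 => n p n0n p01; rewrite powRr1 ?ler0n //; exact: hB.
  have [b [n0 [b0 hb]]] := matching_arrow_rare e1 m1 f2 nsf e0.
  exists b, n0; split=> // n p n0n p01; rewrite powRr1 ?ler0n //; exact: hb.
- move=> h; apply: threshold_intro; first by rewrite divr_gt0.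
    case: h => [[nf ch]|[m2 c2]] e e0.
      exact: cherry_arrow_likely e1' ch (density_ge1 R nf) e0.
    exact: two_matching_arrow_likely e1' m2 c2 e0.
  by move=> e e0; apply: arrow_rare_density e1' e2 e0.
move=> k f1 ck ch.
have k1 : (1 < k)%N.
  have /card_gt0P [d dH] := e1'.
  by rewrite -ck -(edge_card dH); apply/subset_leq_card/edge_nonisolated.
apply: threshold_intro.
- by rewrite divr_gt0 ?ltr0n ?subr_gt0 ?ltr1n // ltnW.
- by move=> e e0; apply: forest_arrow_likely e1' ch f1 ck k1 e0.
- by move=> e e0; apply: forest_arrow_rare ch ck k1 e0.
Qed.
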